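(* Let $M_n$ be an $n\times n$ Wigner Hermitian matrix. (1) (First moment) If $n$ is odd, then $\mathbf{E}\det M_n=0$. If $n$ is even, then $$\mathbf{E}\det M_n = (-1)^{n/2}\frac{n!}{(n/2)!\,2^{n/2}}.$$ In particular, for $n$ even, $$\mathbf{E}\det M_n=\left(\frac{(-1)^{n/2}2^{1/4}}{\pi^{1/4}}+o(1)\right)n^{-1/4}\sqrt{n!}.$$ (2) (Second moment) If $M_n$ is drawn from GOE, then $$n^{3/2}\,n!\ll \mathbf{E}|\det M_n|^2\ll n^{3/2}\,n!,$$ while if $M_n$ is drawn from GUE, then $$n^{1/2}\,n!\ll \mathbf{E}|\det M_n|^2\ll n^{1/2}\,n!.$$
   Context: An $n\times n$ Wigner Hermitian matrix $M_n=(\zeta_{ij})_{1\le i,j\le n}$ is a random Hermitian matrix whose entries $\zeta_{ij}$, $1\le i\le j\le n$ (complex for $i<j$, real for $i=j$), are jointly independent, with mean zero and variance one ($\mathbf{E}|\zeta_{ij}|^2=1$) for $i<j$, and mean zero and variance $\sigma^2$ for $i=j$, where $\sigma^2>0$ is independent of $n$. $N(\mu,v)_{\mathbb R}$ is the real Gaussian law of mean $\mu$ and variance $v$; $N(0,1)_{\mathbb C}$ is the complex Gaussian law whose real and imaginary parts are independent with law $N(0,\frac12)_{\mathbb R}$. GUE is the Wigner ensemble with $\zeta_{ij}\equiv N(0,1)_{\mathbb C}$ for $i<j$ and $\zeta_{ii}\equiv N(0,1)_{\mathbb R}$. GOE is the Wigner ensemble with $\zeta_{ij}\equiv N(0,1)_{\mathbb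 R}$ for $i<j$ and $\zeta_{ii}\equiv N(0,2)_{\mathbb R}$. The parameter $n$ is a natural number going to infinity. $X\ll Y$ means $|X|\le CY$ for some constant $C$ independent of $n$; $o(1)$ denotes a quantity tending to $0$ as $n\to\infty$. *)

(* Defs.v *)
From HB Require Import structures.
From mathcomp Require Import all_boot all_order all_algebra.
From mathcomp Require Import all_classical all_reals all_analysis.
From mathcomp Require Export complex.

Set Implicit Arguments.
Unset Strict Implicit.
Unset Printing Implicit Defensive.

Import Order.TTheory GRing.Theory Num.Theory.
Import numFieldNormedType.Exports.

Local Open Scope classical_set_scope.
Local Open Scope ring_scope.

Section ComplexRandomVariables.
Context {d : measure_display} {T : measurableType d} {R : realType}.
Variable P : probability T R.

(* Product rule over every finite subfamily of the family indexed by D. *)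
Definition mutually_independent {d' : measure_display} {T' : measurableType d'}
    {I : finType} (D : pred I) (X : I -> T -> T') : Prop :=
  forall A : {set I}, {subset A <= D} ->
  forall B : I -> set T', (forall i, measurable (B i)) ->
  P (\bigcap_(i in [set` A]) (X i @^-1` B i)) =
  (\prod_(i in A) P (X i @^-1` B i))%E.

(* R[i] has no Borel structure in the library; complex random variables are
   measured through the identification of R[i] with R * R. *)
Definition re_im (z : R[i]) : R * R := (complex.Re z, complex.Im z).

(* An equality of extended reals with finite right-hand sides, hence it
   includes the integrability of the (measurable) variable Z. *)
Definition has_expectation (Z : T -> R[i]) (z : R[i]) : Prop :=
  ('E_P[fun t => complex.Re (Z t)] = (complex.Re z)%:E)%E /\
  ('E_P[fun t => complex.Im (Z t)] = (complex.Im z)%:E)%E.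

Definition abs_sq_expectation (Z : T -> R[i]) : \bar R :=
  ('E_P[fun t => (ComplexField.Normc.normc (Z t) ^+ 2)%R])%E.

(* The second argument of normal_prob is the standard deviation, whereas v is
   the variance. *)
Definition has_gaussian_law (X : T -> R) (mu v : R) : Prop :=
  forall A : set R, measurable A ->
  pushforward P X A = normal_prob mu (Num.sqrt v) A.

(* The law of Z on the complex plane is N(mu, v)_R, carried by the real line. *)
Definition has_real_gaussian_law (Z : T -> R[i]) (mu v : R) : Prop :=
  {ae P, forall t, complex.Im (Z t) = 0} /\
  has_gaussian_law (fun t => complex.Re (Z t)) mu v.

(* N(0, 1)_C is normalized by E|Z|^2 = 1, so each part has variance 1/2. *)
Definition has_std_complex_gaussian_law (Z : T -> R[i]) : Prop :=
  [/\ has_gaussian_law (fun t => complex.Re (Z t)) 0 2^-1,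
      has_gaussian_law (fun t => complex.Im (Z t)) 0 2^-1 &
      mutually_independent predT
        (fun (b : bool) t =>
           if b then complex.Re (Z t) else complex.Im (Z t))].

Definition wigner_hermitian (sigma2 : R) (n : nat) (M : T -> 'M[R[i]]_n) :
    Prop :=
  [/\ forall t, M t \is hermsymmx,
      forall i j, measurable_fun [set: T] (fun t => re_im (M t i j)),
      mutually_independent (fun k : 'I_n * 'I_n => (k.1 <= k.2)%N)
        (fun k t => re_im (M t k.1 k.2)),
      forall i j : 'I_n, (i < j)%N ->
        has_expectation (fun t => M t i j) 0 /\
        abs_sq_expectation (fun t => M t i j) = 1%:E &
      forall i : 'I_n,
        has_expectation (fun t => M t i i) 0 /\
        abs_sq_expectation (fun t => M t i i) = sigma2%:E].

Definition GOE (n : nat) (M : T -> 'M[R[i]]_n) : Prop :=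
  [/\ wigner_hermitian 2 M,
      forall i j : 'I_n, (i < j)%N ->
        has_real_gaussian_law (fun t => M t i j) 0 1 &
      forall i : 'I_n, has_real_gaussian_law (fun t => M t i i) 0 2].

Definition GUE (n : nat) (M : T -> 'M[R[i]]_n) : Prop :=
  [/\ wigner_hermitian 1 M,
      forall i j : 'I_n, (i < j)%N ->
        has_std_complex_gaussian_law (fun t => M t i j) &
      forall i : 'I_n, has_real_gaussian_law (fun t => M t i i) 0 1].

End ComplexRandomVariables.

(* Main.v *)
(** Write D(f, g) for the minor of M with rows f and columns g, and C_kl for
    the cofactors of M[f, f]. Expanding along row and column v gives
    D(vf, vf) = M_vv D(f, f) - sum_(k, l) M_(v, f l) M_(f k, v) C_kl, where the
    entries with index v are independent of M[f, f]. Hence d_m = E det M_m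
    satisfies d_(m+2) = -(m+1) d_m, which gives the first moment; its
    asymptotics come from Wallis' product.

    For the second moment u_m = E (det M_m)^2 put beta = 1 (GUE) or 2 (GOE).
    Wick's formula for row v gives
    u_(m+1) = beta u_m + sum_(k, l) E (C_kk C_ll + beta C_kl C_lk), and the same
    computation with two new indices v, w gives
    E (D(vf, vf) D(wf, wf) + beta D(vf, wf) D(wf, vf)) = u_(m+1), a trace of the
    rotation invariance of the ensemble. This evaluates the terms with k <> l,
    so that u_(m+1) = beta u_m + m (m + beta) u_(m-1), whose solution is
    expressed by m! and the central binomial coefficients. *)

Require Import Defs.
From HB Require Import structures.
From mathcomp Require Import all_boot all_order all_algebra.
From mathcomp Require Import fingroup perm.
From mathcomp Require Import all_classical all_reals all_analysis.
From mathcomp Require Import complex.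
From mathcomp Require Import measurable_realfun ring lra zify.

Set Implicit Arguments.
Unset Strict Implicit.
Unset Printing Implicit Defensive.

Import Order.TTheory GRing.Theory Num.Theory.
Import numFieldNormedType.Exports.

Local Open Scope classical_set_scope.
Local Open Scope ring_scope.

Import HBNNSimple.

(** A general Wigner matrix has only two moments, so the integrability of a long product of entries
    cannot rest on Hölder's inequality; it has to come from independence. This works for minors
    because a term of the Leibniz formula uses each position once, so that an independent entry
    occurs at most together with its own conjugate. Products of two minors repeat positions and ask
    for higher moments, which the Gaussian law provides.

    No submatrix is ever treated as a new ensemble. All minors are taken in one fixed matrix, along
    injective index lists, and a border is an index outside the list.

    The rotation invariance of GUE and GOE is not established either. The one identity wanted from
    it is read off from expansions, in a form that treats both ensembles at once: besides the
    moments common to all Wigner matrices, the parameter beta enters through [E M_ii^2 = beta],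
    [E M_ij^2 = beta - 1] and [E |M_ij|^4 = beta + 1], and the value 2 brings with it the symmetry
    of cofactors. *)

Local Notation Re := complex.Re.
Local Notation Im := complex.Im.

(** * Determinant of a bordered matrix *)

Section Bordered.
Variable C : comNzRingType.

Lemma det_bordered m (A : 'M[C]_m.+1) :
  let B := row' ord0 (col' ord0 A) in
  \det A = A ord0 ord0 * \det B -
    \sum_k \sum_l A ord0 (lift ord0 l) * A (lift ord0 k) ord0 * cofactor B k l.
Proof.
move=> B; rewrite (expand_det_row A ord0) big_ord_recl; congr (_ * _ + _).
  by rewrite /cofactor add0n expr0 mul1r.
rewrite exchange_big -sumrN /=; apply: eq_bigr => l _.
(* The minor beside entry [l] of the top row still contains column 0 of [A]; a second expansion,
   along that column, brings in the cofactors of [B]. *)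
rewrite /cofactor; case: m A @B l => [A B []//|m A B l].
rewrite (expand_det_col _ ord0) mulr_sumr mulr_sumr -sumrN.
apply: eq_bigr => k _; rewrite /cofactor !mxE.
(* Both orders of deletion leave [B] without row [k] and column [l]. The column index [l + 1] in [A]
   is what turns the sign into [- (-1)^(k + l)]. *)
rewrite -(_ : row' k (col' l B) =
    row' k (col' ord0 (row' ord0 (col' (lift ord0 l) A)))); last first.
  apply/matrixP => i j; rewrite !mxE; congr (A _ _).
  apply: val_inj; rewrite /= /bump; lia.
rewrite (_ : lift (lift ord0 l) ord0 = ord0); last exact: val_inj.
have -> : (-1) ^+ (ord0 + lift ord0 l) = - (-1) ^+ l :> C.
  by rewrite /= /bump add0n add1n exprS mulN1r.
rewrite addn0 exprD; set x := \det _; ring.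
Qed.

End Bordered.

(** * Index lists and the minors that they select *)

Definition vcons (I : Type) m (v : I) (f : 'I_m -> I) (i : 'I_m.+1) : I :=
  if unlift ord0 i is Some j then f j else v.

Lemma vcons0 (I : Type) m (v : I) (f : 'I_m -> I) : vcons v f ord0 = v.
Proof. by rewrite /vcons unlift_none. Qed.

Lemma vcons_lift (I : Type) m (v : I) (f : 'I_m -> I) j :
  vcons v f (lift ord0 j) = f j.
Proof. by rewrite /vcons liftK. Qed.

Lemma vcons_eta (I : Type) m (f : 'I_m.+1 -> I) :
  f =1 vcons (f ord0) (f \o lift ord0).
Proof.
by move=> i; case: (unliftP ord0 i) => [j|] ->; rewrite ?vcons_lift ?vcons0.
Qed.

Lemma vcons_inj (I : eqType) m (v : I) (f : 'I_m -> I) : injective f ->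
  (forall i, f i != v) -> injective (vcons v f).
Proof.
move=> fI fv i j; case: (unliftP ord0 i) => [k|] ->; case: (unliftP ord0 j) => [l|] ->;
  rewrite ?vcons_lift ?vcons0 //.
- by move=> /fI ->.
- by move=> /eqP; rewrite (negbTE (fv _)).
- by move=> /esym/eqP; rewrite (negbTE (fv _)).
Qed.

(** Lets minors over one index set in two different orders be compared by [minor_perm]. One
    inclusion suffices: the chosen self-map of ['I_m] is injective, hence a permutation. *)
Lemma inj_same_image (I : eqType) m (f g : 'I_m -> I) : injective f ->
  injective g -> (forall i, exists j, g i = f j) ->
  exists s : 'S_m, g =1 f \o s.
Proof.
move=> fI gI fg.
have fg' i : exists j, g i == f j by have [j ->] := fg i; exists j.
pose s i := xchoose (fg' i).
have sP i : g i = f (s i) by apply/eqP; exact: (xchooseP (fg' i)).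
have sI : injective s by move=> i j sij; apply: gI; rewrite !sP sij.
by exists (perm sI) => i /=; rewrite permE -sP.
Qed.

Section Minors.
Variables (C : comNzRingType) (n : nat).
Implicit Types A : 'M[C]_n.

Definition minor m A (f g : 'I_m -> 'I_n) : C := \det (mxsub f g A).

Lemma eq_minor m A (f f' g g' : 'I_m -> 'I_n) : f =1 f' -> g =1 g' ->
  minor A f g = minor A f' g'.
Proof. by move=> ff gg; congr determinant; apply/matrixP => i j; rewrite !mxE ff gg. Qed.

Lemma minor_perm m A (f g : 'I_m -> 'I_n) (s t : 'S_m) :
  minor A (f \o s) (g \o t) = (-1) ^+ s * (-1) ^+ t * minor A f g.
Proof.
rewrite /minor (_ : mxsub (f \o s) (g \o t) A = row_perm s (col_perm t (mxsub f g A))).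
  rewrite row_permE col_permE !det_mulmx !det_perm odd_permV -[RHS]mulrA.
  by congr (_ * _); exact: mulrC.
by apply/matrixP => i j; rewrite !mxE.
Qed.

Definition cominor m A (f g : 'I_m -> 'I_n) (k l : 'I_m) : C :=
  cofactor (mxsub f g A) k l.

Lemma cominorE m A (f g : 'I_m.+1 -> 'I_n) k l :
  cominor A f g k l = (-1) ^+ (k + l) * minor A (f \o lift k) (g \o lift l).
Proof.
rewrite /cominor /cofactor; congr (_ * \det _).
by apply/matrixP => i j; rewrite !mxE.
Qed.

(** [vcons] puts the new index at position 0, where [det_bordered] expands. Row index [v] and column
    index [w] may differ, as the crossed minors of the second moment require. *)
Lemma minor_vcons m A (v w : 'I_n) (f g : 'I_m -> 'I_n) :
  minor A (vcons v f) (vcons w g) = A v w * minor A f g -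
    \sum_k \sum_l A v (g l) * A (f k) w * cominor A f g k l.
Proof.
rewrite /minor det_bordered mxE !vcons0.
rewrite (_ : row' ord0 _ = mxsub f g A); last first.
  by apply/matrixP => i j; rewrite !mxE !vcons_lift.
congr (_ - _); apply: eq_bigr => k _; apply: eq_bigr => l _.
by rewrite !mxE !vcons0 !vcons_lift.
Qed.

Lemma minor0 A (f g : 'I_0 -> 'I_n) : minor A f g = 1.
Proof. exact: det_mx00. Qed.

End Minors.

(** * Contraction of Kronecker deltas *)

Lemma sum_delta (C : pzSemiRingType) (I : finType) (F : I -> C) k :
  \sum_l (l == k)%:R * F l = F k.
Proof.
rewrite (bigD1 k)//= eqxx mul1r big1 ?addr0// => l lk.
by rewrite (negbTE lk) mul0r.
Qed.

(** The three products of deltas are the pairings of four border entries [M_(v,l)], [M_(k,v)],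
    [M_(v,l')], [M_(k',v)], and [G k l k' l'] stands for a mean of two cofactors. Pairing entries
    that both leave [v], or both enter it, costs the weight [b], later [beta - 1]. *)
Lemma sum_wick (C : comNzRingType) (I : finType) (G : I -> I -> I -> I -> C) b :
  \sum_k \sum_l \sum_k' \sum_l'
    ((l == k)%:R * (l' == k')%:R + (l == k')%:R * (l' == k)%:R
     + b * ((l' == l)%:R * (k' == k)%:R)) * G k l k' l' =
  \sum_k \sum_l (G k k l l + G k l l k + b * G k l k l).
Proof.
apply: eq_bigr => k _.
transitivity (\sum_l ((l == k)%:R * \sum_k' G k l k' k') +
    \sum_l (G k l l k) + \sum_l (b * G k l k l)); last first.
  by rewrite (sum_delta (fun l => \sum_k' G k l k' k')) -!big_split.
rewrite -!big_split; apply: eq_bigr => l _ /=.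
transitivity (\sum_k' ((l == k)%:R * G k l k' k') +
    \sum_k' (k' == l)%:R * G k l k' k + \sum_k' (k' == k)%:R * (b * G k l k' l)).
  rewrite -!big_split; apply: eq_bigr => k' _ /=.
  transitivity (\sum_l' ((l' == k')%:R * ((l == k)%:R * G k l k' l')) +
     \sum_l' ((l' == k)%:R * ((k' == l)%:R * G k l k' l')) +
     \sum_l' ((l' == l)%:R * ((k' == k)%:R * (b * G k l k' l')))).
    rewrite -!big_split; apply: eq_bigr => l' _ /=.
    by rewrite (eq_sym l k'); ring.
  by rewrite (sum_delta (fun l' => (l == k)%:R * G k l k' l'))
    (sum_delta (fun l' => (k' == l)%:R * G k l k' l'))
    (sum_delta (fun l' => (k' == k)%:R * (b * G k l k' l'))).
rewrite -mulr_sumr (sum_delta (fun k' => G k l k' k)).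
by rewrite (sum_delta (fun k' => b * G k l k' l)).
Qed.

(** * Comparison of weighted integrals through indicators *)

Section WeightedIntegral.
Context {dT dY : measure_display} {T : measurableType dT}
  {Y : measurableType dY} {R : realType}.
Variables (m : {measure set T -> \bar R}) (X : T -> Y) (w : T -> R).
Hypotheses (mX : measurable_fun [set: T] X) (mw : measurable_fun [set: T] w).
Hypothesis w0 : forall t, 0 <= w t.

Let weighted_nnsfun (f : {nnsfun Y >-> R}) :
  (\int[m]_t ((f (X t))%:E * (w t)%:E) =
   \sum_(r \in range f) r%:E *
     \int[m]_t ((\1_(f @^-1` [set r]) (X t))%:E * (w t)%:E))%E.
Proof.
have m1 (r : R) :
    measurable_fun [set: T] (fun t => (\1_(f @^-1` [set r]) (X t))%:E).
  by apply/measurable_EFinP; apply: measurableT_comp.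
under eq_integral.
  move=> t _; rewrite fimfunE -fsumEFin// ge0_mule_fsuml; last first.
    by move=> ?; rewrite EFinM nnfun_muleindic_ge0.
  over.
rewrite ge0_integral_fsum//.
- apply: eq_fsbigr => r /[!inE] -[y _ <-].
  under eq_integral do rewrite EFinM -muleA.
  rewrite ge0_integralZl ?lee_fin//.
    by apply: emeasurable_funM => //; exact/measurable_EFinP.
  by move=> t _; rewrite mule_ge0 ?lee_fin.
- move=> r; apply: emeasurable_funM => //; last exact/measurable_EFinP.
  under eq_fun do rewrite EFinM.
  by apply: emeasurable_funM.
- by move=> r t _; rewrite mule_ge0 ?lee_fin// -lee_fin EFinM nnfun_muleindic_ge0.
Qed.

(** Monotone convergence along simple functions. The right-hand side involves [m], [X] and [w] only
    through weighted measures of preimages, so that two such triples can be compared set by set. *)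
Lemma ge0_integral_weighted_lim (f : Y -> \bar R)
    (mf : measurable_fun [set: Y] f) : (forall y, 0 <= f y)%E ->
  (\int[m]_t (f (X t) * (w t)%:E) =
   limn (fun n => \sum_(r \in range (nnsfun_approx measurableT mf n))
     r%:E * \int[m]_t ((\1_(nnsfun_approx measurableT mf n @^-1` [set r]) (X t))%:E
                       * (w t)%:E)))%E.
Proof.
move=> f0; pose f_ := nnsfun_approx measurableT mf.
transitivity (limn (fun n => \int[m]_t ((f_ n (X t))%:E * (w t)%:E)))%E; last first.
  by congr (limn _); apply/funext => n; exact: weighted_nnsfun.
rewrite -monotone_convergence//=.
- apply: eq_integral => t _; apply/esym/cvg_lim => //.
  by apply: cvgeZr => //; exact: cvg_nnsfun_approx.
- move=> n; apply: emeasurable_funM; last exact/measurable_EFinP.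
  by apply/measurable_EFinP; apply: measurableT_comp.
- by move=> n t _; rewrite mule_ge0 ?lee_fin.
- move=> t _ p q pq; rewrite lee_pmul ?lee_fin//.
  by exact/lefP/nd_nnsfun_approx.
Qed.

End WeightedIntegral.

(** Serves twice: with the remaining factors of a product as weight, for independence, and with a
    density as weight, for the Gaussian law. *)
Lemma ge0_integral_weighted_eq {d1 d2 dY : measure_display}
    {T1 : measurableType d1} {T2 : measurableType d2} {Y : measurableType dY}
    {R : realType} (m1 : {measure set T1 -> \bar R})
    (m2 : {measure set T2 -> \bar R}) (X1 : T1 -> Y) (X2 : T2 -> Y)
    (w1 : T1 -> R) (w2 : T2 -> R) (f : Y -> \bar R) :
  measurable_fun setT X1 -> measurable_fun setT X2 ->
  measurable_fun setT w1 -> measurable_fun setT w2 ->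
  (forall t, 0 <= w1 t) -> (forall t, 0 <= w2 t) ->
  measurable_fun setT f -> (forall y, 0 <= f y)%E ->
  (forall B, measurable B ->
    \int[m1]_t ((\1_B (X1 t))%:E * (w1 t)%:E) =
    \int[m2]_t ((\1_B (X2 t))%:E * (w2 t)%:E))%E ->
  (\int[m1]_t (f (X1 t) * (w1 t)%:E) = \int[m2]_t (f (X2 t) * (w2 t)%:E))%E.
Proof.
move=> mX1 mX2 mw1 mw2 w10 w20 mf f0 w12.
rewrite (ge0_integral_weighted_lim _ mX1 mw1 w10 mf f0).
rewrite (ge0_integral_weighted_lim _ mX2 mw2 w20 mf f0); apply: congr_lim; apply/funext => n.
apply: eq_fsbigr => r _; by rewrite w12.
Qed.

(** * Independence for products of nonnegative functions *)

Section Independence.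
Context {d d' : measure_display} {T : measurableType d}
  {T' : measurableType d'} {R : realType} (P : probability T R).
Variables (I : finType) (D : pred I) (X : I -> T -> T').
Hypothesis mX : forall k, D k -> measurable_fun [set: T] (X k).
Hypothesis indX : mutually_independent P D X.

Let indep_indicators (s : seq I) (B : I -> set T') :
  uniq s -> {subset s <= D} -> (forall k, measurable (B k)) ->
  (\int[P]_t (\prod_(k <- s) \1_(B k) (X k t))%:E =
   (\prod_(k <- s) Rintegral P setT (fun t => \1_(B k) (X k t))%R)%:E)%E.
Proof.
move=> us sD mB.
have sA : {subset [set k in s] <= D} by move=> k; rewrite inE => /sD.
have mXB k : k \in s -> measurable (X k @^-1` B k).
  by move=> ks; rewrite -[_ @^-1` _]setTI; exact: (mX (sD _ ks)).
have := indX sA mB.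
rewrite -(setIT (\bigcap_(i in _) _)) -integral_indic//; last first.
  by apply: fin_bigcap_measurable => // k /=; rewrite inE => /mXB.
have -> : (\int[P]_t (\prod_(k <- s) \1_(B k) (X k t))%:E =
  \int[P]_x (\1_(\bigcap_(i in [set` [set k in s]]) X i @^-1` B i) x)%:E)%E.
  apply: eq_integral => t _; congr EFin; rewrite indicE.
  case: (boolP (t \in _)).
    rewrite inE /= => tB; rewrite big_seq big1// => k ks.
    by rewrite indicE mem_set//; apply: tB; rewrite /= inE.
  rewrite notin_setE => tB.
  apply/eqP; rewrite prodf_seq_eq0; apply: contra_notT tB.
  move=> /hasPn tB k /=; rewrite inE => ks.
  have := tB k ks; rewrite andTb indicE pnatr_eq0 eqb0 negbK inE.
  by [].
move=> ->; rewrite (eq_bigl (mem s)); last by move=> k; rewrite !inE.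
rewrite -big_uniq// -prodEFin [LHS]big_seq [RHS]big_seq.
apply: eq_bigr => k ks; rewrite /Rintegral.
under [in RHS]eq_integral.
  move=> t _; rewrite (_ : \1_(B k) (X k t) = \1_(X k @^-1` B k) t)%R//.
  over.
by rewrite integral_indic ?setIT// ?fineK// ?fin_num_measure//; exact: mXB.
Qed.

(** Indicators are replaced by general functions one factor at a time: those of [s1] are general,
    those of [s2] still indicators, and the induction runs over [s1]. Integrability keeps
    [Rintegral] from reading an infinite integral as 0. *)
Let nonneg_factors (s1 s2 : seq I) (f : I -> T' -> R) :
  uniq (s1 ++ s2) -> {subset s1 ++ s2 <= D} ->
  (forall k, measurable_fun setT (f k)) -> (forall k y, 0 <= f k y) ->
  (forall k, k \in s1 -> P.-integrable setT (fun t => (f k (X k t))%:E)) ->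
  (forall k, k \in s2 -> exists2 B, measurable B & f k = \1_B) ->
  (\int[P]_t (\prod_(k <- s1 ++ s2) f k (X k t))%:E =
   (\prod_(k <- s1 ++ s2) Rintegral P setT (fun t => f k (X k t)))%:E)%E.
Proof.
elim: s1 s2 f => [|k s1 IH] s2 f us sD mf f0 fi f1.
  have /choice[B BP] (k : I) : exists B, measurable B /\ (k \in s2 -> f k = \1_B).
    case: (boolP (k \in s2)) => ks; last by exists set0; split.
    by have [B mB fB] := f1 k ks; exists B.
  rewrite /=; under eq_integral.
    move=> t _; rewrite big_seq (eq_bigr (fun k => \1_(B k) (X k t))); last first.
      by move=> k /(proj2 (BP k)) ->.
    rewrite -big_seq; over.
  rewrite indep_indicators//; last by move=> k; case: (BP k).
  congr EFin; rewrite [LHS]big_seq [RHS]big_seq; apply: eq_bigr => k ks.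
  by rewrite (proj2 (BP k)).
have kD : D k by apply: sD; rewrite inE eqxx.
have mprod (s : seq I) : {subset s <= D} ->
    measurable_fun setT (fun t => \prod_(j <- s) f j (X j t)).
  move=> ssD; rewrite [X in measurable_fun _ X](_ : _ =
     fun t => \prod_(j <- s) if D j then f j (X j t) else 1); last first.
    apply/funext => t; rewrite [LHS]big_seq [RHS]big_seq.
    by apply: eq_bigr => j /ssD; rewrite unfold_in => ->.
  apply: measurable_prod => j _.
  case: (boolP (D j)) => [Dj|_]; last exact: measurable_cst.
  by apply: measurableT_comp => //; exact: mX.
have subD : {subset s1 ++ s2 <= D}.
  by move=> j js; apply: sD; rewrite inE js orbT.
pose c := \prod_(j <- s1 ++ s2) Rintegral P setT (fun t => f j (X j t)).
have c0 : 0 <= c by apply: prodr_ge0 => j _; apply: Rintegral_ge0.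
have kint : ((Rintegral P setT (fun t => f k (X k t)))%:E
  = \int[P]_t (f k (X k t))%:E)%E.
  by rewrite /Rintegral fineK//; apply: integrable_fin_num => //; apply: fi; rewrite inE eqxx.
have kconst : (\int[P]_t ((f k (X k t))%:E * c%:E) =
   \int[P]_t (f k (X k t))%:E * c%:E)%E.
  rewrite ge0_integralZr//=.
  - by apply/measurable_EFinP/measurableT_comp => //; exact: mX.
  - by move=> t _; rewrite lee_fin.
rewrite big_cons EFinM kint -/c -kconst.
under eq_integral do rewrite big_cons EFinM.
(* The same variable [X k] carries two weights, the product of the other factors and the constant
   [c]. It remains to test indicators in place of [f k]. *)
apply: (@ge0_integral_weighted_eq _ _ _ _ _ _ _ P P (X k) (X k)
  (fun t => \prod_(j <- s1 ++ s2) f j (X j t)) (cst c) (EFin \o f k)) => //.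
- exact: mX.
- exact: mX.
- exact: mprod.
- by move=> t; apply: prodr_ge0.
- exact/measurable_EFinP.
- by move=> y; rewrite lee_fin.
move=> B mB.
(* With the indicator in place of [f k], the index [k] moves from [s1] to [s2] and the induction
   hypothesis applies. *)
pose g j := if j == k then \1_B else f j.
have kn : k \notin s1 ++ s2 by move: us => /= /andP[].
have kn1 : k \notin s1 by move: kn; rewrite mem_cat; case/norP.
have kn2 : k \notin s2 by move: kn; rewrite mem_cat; case/norP.
have pe : perm_eq (s1 ++ k :: s2) (k :: s1 ++ s2) by rewrite -cat1s perm_catCA.
have fg (s : seq I) : k \notin s -> {in s, g =1 f}.
  by move=> ks j js; rewrite /g; case: eqP => // jk; rewrite -jk js in ks.
have gk : g k = \1_B by rewrite /g eqxx.
have gi : (\int[P]_t (\prod_(j <- s1 ++ k :: s2) g j (X j t))%:E =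
    \int[P]_t ((\1_B (X k t))%:E * (\prod_(j <- s1 ++ s2) f j (X j t))%:E))%E.
  apply: eq_integral => t _; rewrite (perm_big _ pe)/= big_cons gk EFinM.
  congr (_ * _%:E)%E.
  by rewrite [LHS]big_seq [RHS]big_seq; apply: eq_bigr => j /(fg _ kn)->.
have gc : \prod_(j <- s1 ++ k :: s2) Rintegral P setT (fun t => g j (X j t)) =
    Rintegral P setT (fun t => \1_B (X k t)) * c.
  rewrite (perm_big _ pe)/= big_cons gk; congr (_ * _).
  by rewrite [LHS]big_seq [RHS]big_seq; apply: eq_bigr => j /(fg _ kn)->.
rewrite -gi IH.
- have mBk : measurable_fun setT (fun t => (\1_B (X k t))%:E : \bar R).
    by apply/measurable_EFinP; apply: measurableT_comp => //; exact: mX.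
  rewrite gc EFinM /Rintegral fineK.
    by rewrite -ge0_integralZr.
  rewrite (_ : (fun _ => _) = (fun t => (\1_(X k @^-1` B) t)%:E)); last by [].
  have mXB : measurable (X k @^-1` B).
    by rewrite -[_ @^-1` _]setTI; exact: (mX kD).
  by rewrite integral_indic// fin_num_measure// setIT.
- by rewrite (perm_uniq pe).
- by move=> j; rewrite (perm_mem pe); exact: sD.
- by move=> j; rewrite /g; case: eqP.
- by move=> j y; rewrite /g; case: eqP.
- move=> j js; have := fi j; rewrite inE js orbT => /(_ isT).
  by rewrite /g; case: eqP => // jk; rewrite -jk js in kn1.
- move=> j; rewrite inE; case: eqP => [->|jk /= js]; first by exists B.
  by rewrite /g; case: eqP => // _; exact: f1.
Qed.

Lemma ge0_indep_prod (s : seq I) (f : I -> T' -> R) :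
  uniq s -> {subset s <= D} ->
  (forall k, measurable_fun setT (f k)) -> (forall k y, 0 <= f k y) ->
  (forall k, k \in s -> P.-integrable setT (fun t => (f k (X k t))%:E)) ->
  (\int[P]_t (\prod_(k <- s) f k (X k t))%:E =
   (\prod_(k <- s) Rintegral P setT (fun t => f k (X k t)))%:E)%E.
Proof.
move=> us sD mf f0 fi; rewrite -[s]cats0.
by apply: nonneg_factors; rewrite ?cats0.
Qed.

End Independence.

(** * Complex random variables and their expectation *)

Section ComplexMeasurable.
Context {d : measure_display} {T : measurableType d} {R : realType}.
Implicit Types Z W : T -> R[i].

Definition cmeasurable Z :=
  measurable_fun setT (fun t => Re (Z t)) /\
  measurable_fun setT (fun t => Im (Z t)).

Lemma ReM (z w : R[i]) : Re (z * w) = Re z * Re w - Im z * Im w.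
Proof. by case: z w => [a b] [c e]. Qed.

Lemma ImM (z w : R[i]) : Im (z * w) = Re z * Im w + Im z * Re w.
Proof. by case: z w => [a b] [c e]. Qed.

Lemma ReD (z w : R[i]) : Re (z + w) = Re z + Re w.
Proof. by case: z w => [a b] [c e]. Qed.

Lemma ImD (z w : R[i]) : Im (z + w) = Im z + Im w.
Proof. by case: z w => [a b] [c e]. Qed.

Lemma cmeasurable_cst (c : R[i]) : cmeasurable (fun=> c).
Proof. by split. Qed.

Lemma cmeasurableM Z W :
  cmeasurable Z -> cmeasurable W -> cmeasurable (fun t => Z t * W t).
Proof.
move=> [ZR ZI] [WR WI]; split.
- under eq_fun do rewrite ReM.
  by apply: measurable_funB; exact: measurable_funM.
- under eq_fun do rewrite ImM.
  by apply: measurable_funD; exact: measurable_funM.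
Qed.

Lemma cmeasurable_prod (I : Type) (s : seq I) (F : I -> T -> R[i]) :
  (forall k, cmeasurable (F k)) -> cmeasurable (fun t => \prod_(k <- s) F k t).
Proof.
move=> mF; elim: s => [|k s IH].
  by under eq_fun do rewrite big_nil; exact: cmeasurable_cst.
by under eq_fun do rewrite big_cons; exact: cmeasurableM.
Qed.

Lemma cmeasurable_conj Z : cmeasurable Z -> cmeasurable (fun t => conjc (Z t)).
Proof.
move=> [ZR ZI]; split.
- by rewrite (_ : (fun _ => _) = (fun t => Re (Z t)))//; apply/funext => t; case: (Z t).
- rewrite (_ : (fun _ => _) = (fun t => - Im (Z t))); last by apply/funext => t; case: (Z t).
  exact: measurable_funN.
Qed.

End ComplexMeasurable.

Section ComplexExpectation.
Context {d : measure_display} {T : measurableType d} {R : realType}.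
Variable P : probability T R.
Implicit Types Z W : T -> R[i].

Definition cintegrable Z :=
  P.-integrable setT (fun t => (Re (Z t))%:E) /\
  P.-integrable setT (fun t => (Im (Z t))%:E).

(** A total function, with infinite integrals read as 0; hence the rules of calculation carry
    integrability along with the value. *)
Definition cexpect Z : R[i] :=
  Complex (Rintegral P setT (fun t => Re (Z t)))
          (Rintegral P setT (fun t => Im (Z t))).

Lemma cintegrable_measurable Z : cintegrable Z -> cmeasurable Z.
Proof.
by move=> [/measurable_int/measurable_EFinP ? /measurable_int/measurable_EFinP ?].
Qed.

Lemma cintegrable_has_expectation Z :
  cintegrable Z -> has_expectation P Z (cexpect Z).
Proof.
move=> [ZR ZI]; split.
- by rewrite unlock /= /Rintegral fineK//; exact: integrable_fin_num.
- by rewrite unlock /= /Rintegral fineK//; exact: integrable_fin_num.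
Qed.

Lemma has_expectation_cintegrable Z z : cmeasurable Z -> has_expectation P Z z ->
  cintegrable Z /\ cexpect Z = z.
Proof.
move=> [ZR ZI]; rewrite /has_expectation unlock => -[ER EI].
have fi (f : T -> R) r : measurable_fun setT f ->
    (\int[P]_t (f t)%:E = r%:E)%E -> P.-integrable setT (fun t => (f t)%:E).
  move=> mf fr; apply/integrableP; split; first exact/measurable_EFinP.
  by rewrite integral_fin_num_abs ?fr.
split; first by split; [exact: fi ER|exact: fi EI].
by rewrite /cexpect /Rintegral ER EI; case: (z).
Qed.

Lemma cexpect_cst c : cintegrable (fun=> c) /\ cexpect (fun=> c) = c.
Proof.
split; first by split; apply: finite_measure_integrable_cst.
by rewrite /cexpect !Rintegral_cst//= probability_setT !mulr1; case: c.
Qed.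

Lemma cexpectD Z W : cintegrable Z -> cintegrable W ->
  cintegrable (fun t => Z t + W t) /\
  cexpect (fun t => Z t + W t) = cexpect Z + cexpect W.
Proof.
move=> [ZR ZI] [WR WI].
have eR : (fun t => Re (Z t + W t)) = (fun t => Re (Z t) + Re (W t)).
  by apply/funext => t; rewrite ReD.
have eI : (fun t => Im (Z t + W t)) = (fun t => Im (Z t) + Im (W t)).
  by apply/funext => t; rewrite ImD.
split.
  split; under eq_fun do rewrite ?ReD ?ImD EFinD; exact: integrableD.
by rewrite /cexpect eR eI !RintegralD.
Qed.

Lemma cexpectZ c Z : cintegrable Z ->
  cintegrable (fun t => c * Z t) /\ cexpect (fun t => c * Z t) = c * cexpect Z.
Proof.
move=> [ZR ZI].
have rZ r (f : T -> R) : P.-integrable setT (fun t => (f t)%:E) ->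
    P.-integrable setT (fun t => (r * f t)%:E).
  by move=> fi; under eq_fun do rewrite EFinM; exact: integrableZl.
have eR : (fun t => Re (c * Z t)) = (fun t => Re c * Re (Z t) - Im c * Im (Z t)).
  by apply/funext => t; rewrite ReM.
have eI : (fun t => Im (c * Z t)) = (fun t => Re c * Im (Z t) + Im c * Re (Z t)).
  by apply/funext => t; rewrite ImM.
split.
  split.
    under eq_fun do rewrite ReM EFinB; apply: integrableB => //; exact: rZ.
  under eq_fun do rewrite ImM EFinD; apply: integrableD => //; exact: rZ.
rewrite /cexpect eR eI RintegralB ?RintegralD//; try exact: rZ.
by rewrite !RintegralZl//; case: c {eR eI} => a b /=; congr Complex.
Qed.

Lemma cexpect_sum (I : eqType) (s : seq I) (F : I -> T -> R[i]) :
  {in s, forall k, cintegrable (F k)} ->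
  cintegrable (fun t => \sum_(k <- s) F k t) /\
  cexpect (fun t => \sum_(k <- s) F k t) = \sum_(k <- s) cexpect (F k).
Proof.
elim: s => [_|k s IH Fi].
  by under eq_fun do rewrite big_nil; rewrite big_nil; exact: cexpect_cst.
under eq_fun do rewrite big_cons.
have [|Fs Es] := IH; first by move=> j js; apply: Fi; rewrite inE js orbT.
have [|] := @cexpectD (F k) _ _ Fs; first by apply: Fi; rewrite inE eqxx.
by move=> ? ->; rewrite big_cons Es.
Qed.

End ComplexExpectation.

(** * Independence for products of complex functions *)

Section ComplexIndependence.
Context {d d' : measure_display} {T : measurableType d}
  {T' : measurableType d'} {R : realType} (P : probability T R).
Variables (I : finType) (D : pred I) (X : I -> T -> T').
Hypothesis mX : forall k, D k -> measurable_fun [set: T] (X k).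
Hypothesis indX : mutually_independent P D X.

Let nonneg_factor (f : T' -> R[i]) k :=
  exists g : T' -> R, [/\ measurable_fun setT g, forall y, 0 <= g y,
    P.-integrable setT (fun t => (g (X k t))%:E) & f = fun y => real_complex R (g y)].

Lemma cexpect_real (f : T -> R) :
  cexpect P (fun t => real_complex R (f t)) =
  real_complex R (Rintegral P setT f).
Proof.
by rewrite /cexpect /= Rintegral_cst// mul0r.
Qed.

(** Positive and negative parts of the real and the imaginary part, with their coefficients 1, -1,
    i, -i. *)
Let parts (f : T' -> R[i]) : seq (R[i] * (T' -> R)) :=
  [:: (Complex 1 0, fun y => Num.max (Re (f y)) 0);
      (Complex (-1) 0, fun y => Num.max (- Re (f y)) 0);
      (Complex 0 1, fun y => Num.max (Im (f y)) 0);
      (Complex 0 (-1), fun y => Num.max (- Im (f y)) 0)].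

Let maxB (x : R) : Num.max x 0 - Num.max (- x) 0 = x.
Proof. by rewrite /Num.max; case: ifP; case: ifP; lra. Qed.

Let partsE f y : f y = \sum_(p <- parts f) p.1 * real_complex R (p.2 y).
Proof.
rewrite /parts !big_cons big_nil /=; apply/eqP; rewrite eq_complex !ReD !ImD !ReM !ImM /=.
by have := maxB (Re (f y)); have := maxB (Im (f y)) => mI mR;
  apply/andP; split; apply/eqP; lra.
Qed.

Let nonneg_factor_max (h : T' -> R) k : D k -> measurable_fun setT h ->
  P.-integrable setT (fun t => (h (X k t))%:E) ->
  nonneg_factor (fun y => real_complex R (Num.max (h y) 0)) k.
Proof.
move=> Dk mh ih; exists (fun y => Num.max (h y) 0); split => //.
- exact: measurable_maxr.
- by move=> y; rewrite le_max lexx orbT.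
- apply: le_integrable ih => //.
    apply/measurable_EFinP; apply: measurable_maxr => //.
    by apply: measurableT_comp => //; exact: mX.
  move=> t _; rewrite lee_fin /Num.max; case: ifP => //.
  by rewrite normr0.
Qed.

Let nonneg_factor_parts (f : T' -> R[i]) k p : D k -> cmeasurable f ->
  cintegrable P (fun t => f (X k t)) -> p \in parts f ->
  nonneg_factor (fun y => real_complex R (p.2 y)) k.
Proof.
move=> Dk [mR mI] [iR iI].
have iN (h : T -> R) : P.-integrable setT (fun t => (h t)%:E) ->
    P.-integrable setT (fun t => (- h t)%:E).
  by move=> ih; under eq_fun do rewrite EFinN; exact: integrableN.
rewrite /parts !inE => /or4P[] /eqP-> /=; apply: nonneg_factor_max => //.
- exact: measurable_funN.
- exact: iN.
- exact: measurable_funN.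
- exact: iN.
Qed.

(** The same replacement of one factor at a time: a complex factor splits into four nonnegative
    parts, each of which joins [s2], and linearity reassembles them. *)
Let mixed_factors (s1 s2 : seq I) (f : I -> T' -> R[i]) :
  uniq (s1 ++ s2) -> {subset s1 ++ s2 <= D} ->
  (forall k, k \in s1 -> cmeasurable (f k)) ->
  (forall k, k \in s1 -> cintegrable P (fun t => f k (X k t))) ->
  (forall k, k \in s2 -> nonneg_factor (f k) k) ->
  cintegrable P (fun t => \prod_(k <- s1 ++ s2) f k (X k t)) /\
  cexpect P (fun t => \prod_(k <- s1 ++ s2) f k (X k t)) =
  \prod_(k <- s1 ++ s2) cexpect P (fun t => f k (X k t)).
Proof.
elim: s1 s2 f => [|k s1 IH] s2 f us sD mf fi f1.
  have /choice[g gP] (k : I) : exists g : T' -> R, [/\ measurable_fun setT g,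
      forall y, 0 <= g y & k \in s2 -> 
      P.-integrable setT (fun t => (g (X k t))%:E) /\
      f k = fun y => real_complex R (g y)].
    case: (boolP (k \in s2)) => ks; last by exists (fun=> 0); split.
    by have [g [mg g0 gi gE]] := f1 k ks; exists g.
  have fE : (fun t => \prod_(k <- s2) f k (X k t)) =
      fun t => real_complex R (\prod_(k <- s2) g k (X k t)).
    apply/funext => t; rewrite rmorph_prod [LHS]big_seq [RHS]big_seq.
    by apply: eq_bigr => k ks; have [_ _ /(_ ks)[_ ->]] := gP k.
  have gprod : (\int[P]_t (\prod_(k <- s2) g k (X k t))%:E =
      (\prod_(k <- s2) Rintegral P setT (fun t => g k (X k t)))%:E)%E.
    apply: (ge0_indep_prod mX indX) => //.
    - by move=> k; have [] := gP k.
    - by move=> k; have [] := gP k.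
    - by move=> k ks; have [_ _ /(_ ks)[]] := gP k.
  rewrite /= fE cexpect_real /Rintegral gprod /=; split.
    split; last exact: finite_measure_integrable_cst.
    apply/integrableP; split.
      apply/measurable_EFinP => /=.
      rewrite [X in measurable_fun _ X](_ : _ =
        fun t => \prod_(j <- s2) if D j then g j (X j t) else 1); last first.
        apply/funext => t; rewrite [LHS]big_seq [RHS]big_seq.
        by apply: eq_bigr => j /sD; rewrite unfold_in => ->.
      apply: measurable_prod => j _.
      case: (boolP (D j)) => [Dj|_]; last exact: measurable_cst.
      by apply: measurableT_comp; [case: (gP j)|exact: mX].
    under eq_integral.
      move=> t _; rewrite /= ger0_norm; last first.
        by apply: prodr_ge0 => k _; case: (gP k).
      over.
    by rewrite gprod ltry.
  rewrite rmorph_prod [LHS]big_seq [RHS]big_seq; apply: eq_bigr => k ks.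
  by have [_ _ /(_ ks)[_ ->]] := gP k; rewrite cexpect_real.
have kD : D k by apply: sD; rewrite inE eqxx.
have kn : k \notin s1 ++ s2 by move: us => /= /andP[].
have kn1 : k \notin s1 by move: kn; rewrite mem_cat; case/norP.
have kn2 : k \notin s2 by move: kn; rewrite mem_cat; case/norP.
have pe : perm_eq (s1 ++ k :: s2) (k :: s1 ++ s2) by rewrite -cat1s perm_catCA.
have fk : cintegrable P (fun t => f k (X k t)) by apply: fi; rewrite inE eqxx.
have mk : cmeasurable (f k) by apply: mf; rewrite inE eqxx.
pose c := \prod_(j <- s1 ++ s2) cexpect P (fun t => f j (X j t)).
pose G t := \prod_(j <- s1 ++ s2) f j (X j t).
have step (h : T' -> R[i]) : nonneg_factor h k ->
    cintegrable P (fun t => h (X k t) * G t) /\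
    cexpect P (fun t => h (X k t) * G t) = cexpect P (fun t => h (X k t)) * c.
  move=> hk; pose g j := if j == k then h else f j.
  have fg : {in s1 ++ s2, g =1 f}.
    by move=> j js; rewrite /g; case: eqP => // jk; rewrite -jk js in kn.
  have gk : g k = h by rewrite /g eqxx.
  have := IH (k :: s2) g; rewrite (perm_big _ pe)/= big_cons gk.
  have -> : (fun t => \prod_(j <- s1 ++ k :: s2) g j (X j t)) =
      fun t => h (X k t) * G t.
    apply/funext => t; rewrite (perm_big _ pe)/= big_cons gk; congr (_ * _).
    by rewrite /G [LHS]big_seq [RHS]big_seq; apply: eq_bigr => j /fg->.
  have -> : \prod_(j <- s1 ++ s2) cexpect P (fun t => g j (X j t)) = c.
    by rewrite /c [LHS]big_seq [RHS]big_seq; apply: eq_bigr => j /fg->.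
  apply.
  - by rewrite (perm_uniq pe).
  - by move=> j; rewrite (perm_mem pe); exact: sD.
  - by move=> j js; rewrite fg ?mem_cat ?js//; apply: mf; rewrite inE js orbT.
  - by move=> j js; rewrite fg ?mem_cat ?js//; apply: fi; rewrite inE js orbT.
  - move=> j; rewrite inE; case: eqP => [->|_ /= js]; first by rewrite gk.
    by rewrite fg ?mem_cat ?js ?orbT//; exact: f1.
have fkE : (fun t => \prod_(j <- (k :: s1) ++ s2) f j (X j t)) =
    fun t => \sum_(p <- parts (f k)) p.1 * (real_complex R (p.2 (X k t)) * G t).
  apply/funext => t; rewrite /= big_cons {1}(partsE (f k)) mulr_suml.
  by apply: eq_bigr => p _; rewrite mulrA.
have part p : p \in parts (f k) ->
    cintegrable P (fun t => p.1 * (real_complex R (p.2 (X k t)) * G t)) /\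
    cexpect P (fun t => p.1 * (real_complex R (p.2 (X k t)) * G t)) =
    p.1 * (cexpect P (fun t => real_complex R (p.2 (X k t))) * c).
  move=> pf; have [si <-] := step _ (nonneg_factor_parts kD mk fk pf).
  exact: cexpectZ.
have [//|Fi FE] := @cexpect_sum _ _ _ P _ (parts (f k))
    (fun p t => p.1 * (real_complex R (p.2 (X k t)) * G t)).
  by move=> p /part[].
rewrite fkE; split => //; rewrite {}FE /= big_cons -/c.
rewrite (_ : (fun t => f k (X k t)) =
  fun t => \sum_(p <- parts (f k)) p.1 * real_complex R (p.2 (X k t))); last first.
  by apply/funext => t; rewrite {1}(partsE (f k)).
have pint p : p \in parts (f k) -> cintegrable P (fun t => real_complex R (p.2 (X k t))).
  move=> pf; have [g [mg g0 gi gE]] := nonneg_factor_parts kD mk fk pf.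
  split => /=; last exact: finite_measure_integrable_cst.
  suff -> : p.2 = g by [].
  by apply/funext => y; apply: complexI; rewrite (congr1 (@^~ y) gE).
have [|_ ->] := @cexpect_sum _ _ _ P _ (parts (f k))
    (fun p t => p.1 * real_complex R (p.2 (X k t))).
  by move=> p /pint pi; have [] := cexpectZ p.1 pi.
rewrite mulr_suml [LHS]big_seq [RHS]big_seq; apply: eq_bigr => p pf.
have [_ ->] := part p pf; have [_ ->] := cexpectZ p.1 (pint p pf).
by rewrite mulrA.
Qed.

Theorem indep_prod (s : seq I) (f : I -> T' -> R[i]) :
  uniq s -> {subset s <= D} ->
  (forall k, k \in s -> cmeasurable (f k)) ->
  (forall k, k \in s -> cintegrable P (fun t => f k (X k t))) ->
  cintegrable P (fun t => \prod_(k <- s) f k (X k t)) /\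
  cexpect P (fun t => \prod_(k <- s) f k (X k t)) =
  \prod_(k <- s) cexpect P (fun t => f k (X k t)).
Proof.
move=> us sD mf fi; rewrite -[s]cats0.
by apply: mixed_factors; rewrite ?cats0.
Qed.

End ComplexIndependence.

(** * Monomials in the entries of a Hermitian matrix *)

Lemma hermsymmxE (R : realType) n (A : 'M[R[i]]_n) i j :
  A \is hermsymmx -> A i j = conjc (A j i).
Proof.
by move=> /is_hermitianmxP AE; rewrite {1}AE !mxE expr0 mul1r.
Qed.

Section Monomials.
Context {R : realType} {n : nat}.
Implicit Types (L : seq ('I_n * 'I_n)) (k l : 'I_n * 'I_n).

Definition upper k : 'I_n * 'I_n := if (k.1 <= k.2)%N then k else (k.2, k.1).

Definition is_upper : pred ('I_n * 'I_n) := fun k => (k.1 <= k.2)%N.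

Lemma is_upper_upper k : is_upper (upper k).
Proof.
by rewrite /is_upper /upper; case: ifP => //= /negbT; rewrite -ltnNge => /ltnW.
Qed.

Lemma upper_swap i j : upper (i, j) = upper (j, i).
Proof.
by rewrite /upper /=; case: ltngtP => // /ord_inj ->.
Qed.

Lemma upper_eq k l : (upper k == upper l) = (k == l) || (k == (l.2, l.1)).
Proof.
by case: k l => [a b] [c e]; rewrite /upper /=; case: leqP => ab; case: leqP => ce;
  rewrite !xpair_eqE -!val_eqE /=; lia.
Qed.

(* An entry below the diagonal is the conjugate of its upper reflection. *)
Definition entry_of (l : 'I_n * 'I_n) (y : R * R) : R[i] :=
  if (l.1 <= l.2)%N then Complex y.1 y.2 else conjc (Complex y.1 y.2).

(** Only the entries on and above the diagonal are independent. This collects the factors of a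
    monomial that depend on one of them, so that [M_ij] and [M_ji] belong to the same group. *)
Definition upper_factor L k (y : R * R) : R[i] :=
  \prod_(l <- L | upper l == k) entry_of l y.

Lemma cmeasurable_upper_factor L k : cmeasurable (upper_factor L k).
Proof.
have m1 : cmeasurable (fun y : R * R => Complex y.1 y.2).
  by split; [exact: measurable_fst|exact: measurable_snd].
rewrite /upper_factor; under eq_fun do rewrite -big_filter.
apply: cmeasurable_prod => l; rewrite /entry_of.
case: (l.1 <= l.2)%N => //; exact: cmeasurable_conj.
Qed.

Lemma upper_factor_cat L1 L2 k y :
  upper_factor (L1 ++ L2) k y = upper_factor L1 k y * upper_factor L2 k y.
Proof. by rewrite /upper_factor big_cat. Qed.

Lemma upper_factor_notin L k : k \notin map upper L ->
  upper_factor L k = fun=> 1.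
Proof.
move=> kL; apply/funext => y; rewrite /upper_factor big_seq_cond big1// => l.
by move=> /andP[lL /eqP lk]; rewrite -lk map_f in kL.
Qed.

End Monomials.

(** * Expectations of monomials and polynomials in the entries *)

Section MatrixMoments.
Context {d : measure_display} {T : measurableType d} {R : realType}.
Variables (P : probability T R) (n : nat) (M : T -> 'M[R[i]]_n).
Hypothesis herm : forall t, M t \is hermsymmx.
Hypothesis mM : forall i j, measurable_fun [set: T] (fun t => re_im (M t i j)).
Hypothesis indM : mutually_independent P (fun k : 'I_n * 'I_n => (k.1 <= k.2)%N)
  (fun k t => re_im (M t k.1 k.2)).
Implicit Types (L : seq ('I_n * 'I_n)).

Definition mono L t : R[i] := \prod_(l <- L) M t l.1 l.2.

(** A condition on single entries; independence turns it into integrability of the whole monomial,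
    whatever its degree. *)
Definition admissible L := forall k, is_upper k ->
  cintegrable P (fun t => upper_factor L k (re_im (M t k.1 k.2))).

Lemma monoE L t :
  mono L t = \prod_(k | is_upper k) upper_factor L k (re_im (M t k.1 k.2)).
Proof.
rewrite /mono (partition_big upper is_upper) /=; last first.
  by move=> k _; exact: is_upper_upper.
apply: eq_bigr => k _; apply: eq_bigr => l /eqP <-.
rewrite /entry_of /upper /=; case: (l.1 <= l.2)%N => /=.
  by case: (M t l.1 l.2).
by rewrite (hermsymmxE _ _ (herm t)); case: (M t l.2 l.1).
Qed.

Lemma expect_mono L : admissible L ->
  cintegrable P (mono L) /\
  cexpect P (mono L) = \prod_(k | is_upper k)
    cexpect P (fun t => upper_factor L k (re_im (M t k.1 k.2))).
Proof.
move=> aL; have -> : mono L = (fun t =>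
    \prod_(k <- enum is_upper) upper_factor L k (re_im (M t k.1 k.2))).
  by apply/funext => t; rewrite monoE big_enum.
rewrite -[X in _ /\ _ = X]big_enum /=.
apply: (indep_prod _ indM) => //.
- exact: enum_uniq.
- by move=> k; rewrite mem_enum.
- by move=> k _; exact: cmeasurable_upper_factor.
- by move=> k; rewrite mem_enum => /aL.
Qed.

Definition upper_disjoint L1 L2 :=
  forall l1 l2, l1 \in L1 -> l2 \in L2 -> upper l1 != upper l2.

Lemma expect_mono_cat L1 L2 : admissible L1 -> admissible L2 ->
  upper_disjoint L1 L2 ->
  admissible (L1 ++ L2) /\
  cexpect P (mono (L1 ++ L2)) = cexpect P (mono L1) * cexpect P (mono L2).
Proof.
move=> a1 a2 L12.
(* At each upper position at most one of the two monomials is present, so that the product of the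
   two groups is one of them. *)
have split12 k : upper_factor (R := R) L1 k = (fun=> 1) \/
    upper_factor (R := R) L2 k = (fun=> 1).
  have [/mapP[l lL kl]|] := boolP (k \in map upper L1); last first.
    by move=> /upper_factor_notin ->; left.
  right; apply: upper_factor_notin; apply/mapP => -[l' lL' kl'].
  by have := L12 _ _ lL lL'; rewrite -kl -kl' eqxx.
have catE k : upper_factor (R := R) (L1 ++ L2) k =
    fun y => upper_factor L1 k y * upper_factor L2 k y.
  by apply/funext => y; rewrite upper_factor_cat.
have a12 : admissible (L1 ++ L2).
  move=> k uk; rewrite catE; have [->|->] := split12 k.
    by under eq_fun do rewrite mul1r; exact: a2.
  by under eq_fun do rewrite mulr1; exact: a1.
split => //; have [_ ->] := expect_mono a12.
have [_ ->] := expect_mono a1; have [_ ->] := expect_mono a2.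
rewrite -big_split; apply: eq_bigr => k uk /=.
rewrite catE; have [->|->] := split12 k.
- rewrite (cexpect_cst P 1).2 mul1r.
  by congr cexpect; apply/funext => t; rewrite mul1r.
- rewrite (cexpect_cst P 1).2 mulr1.
  by congr cexpect; apply/funext => t; rewrite mulr1.
Qed.

Lemma mono_cat L1 L2 t : mono (L1 ++ L2) t = mono L1 t * mono L2 t.
Proof. by rewrite /mono big_cat. Qed.

(** Dependence on the entries with both indices in [W], kept as an explicit combination of
    monomials: independence from entries that leave [W] then reduces to disjoint monomials. *)
Definition polynomial_in (W : pred 'I_n) (G : T -> R[i]) :=
  exists l : seq (R[i] * seq ('I_n * 'I_n)),
    (forall p, p \in l -> admissible p.2 /\
       forall k, k \in p.2 -> W k.1 && W k.2) /\
    G = fun t => \sum_(p <- l) p.1 * mono p.2 t.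

Lemma polynomial_cintegrable W G : polynomial_in W G -> cintegrable P G.
Proof.
move=> [l [lW ->]].
apply: (cexpect_sum (F := fun p t => p.1 * mono p.2 t) _).1 => p /lW[ap _].
by apply: (cexpectZ _ _).1; exact: (expect_mono ap).1.
Qed.

Lemma polynomial_mono W L : admissible L ->
  (forall k, k \in L -> W k.1 && W k.2) -> polynomial_in W (mono L).
Proof.
move=> aL LW; exists [:: (1, L)]; split => [p|].
  by rewrite inE => /eqP ->.
by apply/funext => t; rewrite big_seq1 mul1r.
Qed.

Lemma polynomialD W G H : polynomial_in W G -> polynomial_in W H ->
  polynomial_in W (fun t => G t + H t).
Proof.
move=> [l [lW ->]] [l' [l'W ->]]; exists (l ++ l'); split => [p|].
  by rewrite mem_cat => /orP[/lW|/l'W].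
by apply/funext => t; rewrite big_cat.
Qed.

Lemma polynomialZ W c G : polynomial_in W G ->
  polynomial_in W (fun t => c * G t).
Proof.
move=> [l [lW ->]]; exists [seq (c * p.1, p.2) | p <- l]; split => [p|].
  by move=> /mapP[q /lW[aq qW] ->].
by apply/funext => t; rewrite big_map mulr_sumr; apply: eq_bigr => p _; rewrite mulrA.
Qed.

Lemma polynomial_sum W (I : Type) (s : seq I) (F : I -> T -> R[i]) :
  (forall i, polynomial_in W (F i)) ->
  polynomial_in W (fun t => \sum_(i <- s) F i t).
Proof.
move=> FW; elim: s => [|i s IH].
  exists [::]; split => //; apply/funext => t; by rewrite !big_nil.
under eq_fun do rewrite big_cons; exact: polynomialD.
Qed.

(* Every pair of L has an index outside W, whence independence. *)
Lemma expect_mono_polynomial W L G : admissible L ->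
  (forall k, k \in L -> ~~ (W k.1 && W k.2)) -> polynomial_in W G ->
  cintegrable P (fun t => mono L t * G t) /\
  cexpect P (fun t => mono L t * G t) = cexpect P (mono L) * cexpect P G.
Proof.
move=> aL LW [l [lW ->]].
have cat p : p \in l -> admissible (L ++ p.2) /\
    cexpect P (mono (L ++ p.2)) = cexpect P (mono L) * cexpect P (mono p.2).
  move=> /lW[ap pW]; apply: expect_mono_cat => // l1 l2 /LW l1W /pW l2W.
  rewrite upper_eq; apply: contra l1W => /orP[] /eqP-> //=.
  by rewrite andbC.
have -> : (fun t => mono L t * \sum_(p <- l) p.1 * mono p.2 t) =
    fun t => \sum_(p <- l) p.1 * mono (L ++ p.2) t.
  apply/funext => t; rewrite mulr_sumr; apply: eq_bigr => p _.
  by rewrite mono_cat mulrCA.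
have [|? ->] := @cexpect_sum _ _ _ P _ l (fun p t => p.1 * mono (L ++ p.2) t).
  by move=> p /cat[ap _]; apply: (cexpectZ _ _).1; exact: (expect_mono ap).1.
split => //.
have [|_ ->] := @cexpect_sum _ _ _ P _ l (fun p t => p.1 * mono p.2 t).
  by move=> p /lW[ap _]; apply: (cexpectZ _ _).1; exact: (expect_mono ap).1.
rewrite mulr_sumr [LHS]big_seq [RHS]big_seq; apply: eq_bigr => p pl.
have [ap Ep] := cat p pl.
rewrite (cexpectZ _ (expect_mono ap).1).2 Ep.
by rewrite (cexpectZ _ (expect_mono (lW _ pl).1).1).2 mulrCA.
Qed.

End MatrixMoments.

Section ComplexExpectationSums.
Context {d : measure_display} {T : measurableType d} {R : realType}.
Variable P : probability T R.
Implicit Types Z W : T -> R[i].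

Lemma cexpectB Z W : cintegrable P Z -> cintegrable P W ->
  cintegrable P (fun t => Z t - W t) /\
  cexpect P (fun t => Z t - W t) = cexpect P Z - cexpect P W.
Proof.
move=> Zi Wi; have [Wi' WE] := cexpectZ (-1) Wi.
under eq_fun do rewrite -mulN1r.
by have [? ->] := cexpectD Zi Wi'; rewrite WE mulN1r.
Qed.

Lemma cexpect_sum2 (I J : finType) (F : I -> J -> T -> R[i]) :
  (forall i j, cintegrable P (F i j)) ->
  cintegrable P (fun t => \sum_i \sum_j F i j t) /\
  cexpect P (fun t => \sum_i \sum_j F i j t) = \sum_i \sum_j cexpect P (F i j).
Proof.
move=> Fi.
have G i : cintegrable P (fun t => \sum_j F i j t) /\
    cexpect P (fun t => \sum_j F i j t) = \sum_j cexpect P (F i j).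
  by apply: cexpect_sum => j _; exact: Fi.
have [|? ->] := @cexpect_sum _ _ _ P _ (index_enum I) (fun i t => \sum_j F i j t).
  by move=> i _; exact: (G i).1.
by split => //; apply: eq_bigr => i _; rewrite (G i).2.
Qed.

End ComplexExpectationSums.

(** For even [m] the quotient is [(m-1)!!], the number of perfect matchings of [m] points. The field
    is left open because the formula is needed over [R[i]] and, for the asymptotics, over [R]. *)
Definition mean_det (F : numFieldType) (m : nat) : F :=
  if odd m then 0 else (-1) ^+ m./2 * (m`!%:R / ((m./2)`!%:R * 2 ^+ m./2)).

Lemma mean_detSS (F : numFieldType) m :
  mean_det F m.+2 = - (m.+1%:R * mean_det F m).
Proof.
rewrite /mean_det /= negbK; case: ifP => om; first by rewrite mulr0 oppr0.
rewrite exprS mulN1r mulNr; congr (- _); rewrite [RHS]mulrCA; congr (_ * _).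
have mE : m.+2%:R = 2 * (m./2).+1%:R :> F.
  by rewrite -natrM; congr _%:R; have := odd_double_half m; rewrite om; lia.
rewrite !factS !natrM mE exprS.
have h1 : (m./2).+1%:R != 0 :> F by rewrite pnatr_eq0.
have h2 : (m./2)`!%:R != 0 :> F by rewrite pnatr_eq0 -lt0n fact_gt0.
have h3 : 2 ^+ m./2 != 0 :> F by rewrite expf_neq0// pnatr_eq0.
by field; rewrite h2 h3 nat1r h1.
Qed.

(** * First moment of principal minors *)

Section MinorMoments.
Context {d : measure_display} {T : measurableType d} {R : realType}.
Variables (P : probability T R) (n : nat) (M : T -> 'M[R[i]]_n).
Hypothesis herm : forall t, M t \is hermsymmx.
Hypothesis mM : forall i j, measurable_fun [set: T] (fun t => re_im (M t i j)).
Hypothesis indM : mutually_independent P (fun k : 'I_n * 'I_n => (k.1 <= k.2)%N)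
  (fun k t => re_im (M t k.1 k.2)).
Hypothesis adm_uniq : forall L, uniq L -> admissible P M L.
Local Notation poly W := (polynomial_in P M W).
Local Notation E := (cexpect P).

Definition img m (f : 'I_m -> 'I_n) : pred 'I_n := [pred x | x \in codom f].
Arguments img : simpl never.

Lemma imgE m (f : 'I_m -> 'I_n) i : img f (f i).
Proof. exact: codom_f. Qed.

Lemma img_notin m (f : 'I_m -> 'I_n) v : (forall i, f i != v) -> ~~ img f v.
Proof.
by move=> fv; apply/codomP => -[i vi]; have := fv i; rewrite vi eqxx.
Qed.

(** Injectivity of [f] makes the positions in each Leibniz term distinct, which is all that
    [adm_uniq] asks for. *)
Lemma minor_polynomial m (W : pred 'I_n) (f g : 'I_m -> 'I_n) : injective f ->
  (forall i, W (f i)) -> (forall i, W (g i)) ->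
  poly W (fun t => minor (M t) f g).
Proof.
move=> fI fW gW; rewrite /minor /determinant.
apply: polynomial_sum => s; apply: polynomialZ.
have -> : (fun t => \prod_i mxsub f g (M t) i (s i)) =
    mono M [seq (f i, g (s i)) | i <- enum 'I_m].
  apply/funext => t; rewrite /mono big_map big_enum /=.
  by apply: eq_bigr => i _; rewrite mxE.
apply: polynomial_mono => [|k /mapP[i _ ->] /=]; last by rewrite fW gW.
by apply: adm_uniq; rewrite map_inj_uniq ?enum_uniq// => i j [/fI].
Qed.

Lemma cominor_polynomial m (W : pred 'I_n) (f g : 'I_m -> 'I_n) k l :
  injective f -> (forall i, W (f i)) -> (forall i, W (g i)) ->
  poly W (fun t => cominor (M t) f g k l).
Proof.
case: m f g k l => [f g []//|m] f g k l fI fW gW.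
under eq_fun do rewrite cominorE; apply: polynomialZ.
by apply: minor_polynomial => [i j /fI/lift_inj|i|i] /=.
Qed.

Lemma minor_cintegrable m (f g : 'I_m -> 'I_n) : injective f ->
  cintegrable P (fun t => minor (M t) f g).
Proof.
move=> fI; apply: (polynomial_cintegrable herm mM indM (W := xpredT)).
exact: minor_polynomial.
Qed.

Lemma expect_uniq_mono_polynomial W L G : uniq L ->
  (forall k, k \in L -> ~~ (W k.1 && W k.2)) -> poly W G ->
  cintegrable P (fun t => mono M L t * G t) /\
  E (fun t => mono M L t * G t) = E (mono M L) * E G.
Proof. by move=> /adm_uniq; exact: expect_mono_polynomial. Qed.

Lemma mono1 k : mono M [:: k] = fun t => M t k.1 k.2.
Proof. by apply/funext => t; rewrite /mono big_seq1. Qed.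

Lemma mono2 k l : mono M [:: k; l] = fun t => M t k.1 k.2 * M t l.1 l.2.
Proof. by apply/funext => t; rewrite /mono big_cons big_seq1. Qed.

Hypothesis mean0 : forall i j, E (mono M [:: (i, j)]) = 0.
Hypothesis var1 : forall i j, i != j -> E (mono M [:: (i, j); (j, i)]) = 1.

Lemma expect_mono2 k l : upper k != upper l -> E (mono M [:: k; l]) = 0.
Proof.
move=> kl; rewrite -cat1s.
have [|||_ ->] := @expect_mono_cat _ _ _ P n M herm mM indM [:: k] [:: l].
- exact: adm_uniq.
- exact: adm_uniq.
- by move=> a b; rewrite !inE => /eqP -> /eqP ->.
- by case: k {kl} => i j; rewrite mean0 mul0r.
Qed.

Lemma expect_border v a b : a != v -> b != v ->
  E (mono M [:: (v, a); (b, v)]) = (a == b)%:R.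
Proof.
move=> av bv; have [->|ab] := eqVneq; first by rewrite var1 // eq_sym.
rewrite expect_mono2// upper_eq !xpair_eqE /= eqxx.
by rewrite (negbTE ab) andbF eq_sym (negbTE bv).
Qed.

Lemma expect_minor_step m (f : 'I_m.+2 -> 'I_n) : injective f ->
  E (fun t => minor (M t) f f) =
  - \sum_(k < m.+1) E (fun t => minor (M t) (f \o lift ord0 \o lift k)
                                            (f \o lift ord0 \o lift k)).
Proof.
move=> fI; pose v := f ord0; pose g := f \o lift ord0.
have gI : injective g by move=> i j /fI/lift_inj.
have gv i : g i != v by apply/eqP => /fI/eqP; rewrite eq_sym (negbTE (neq_lift _ _)).
have W0 := img_notin gv.
under eq_fun do rewrite (eq_minor _ (vcons_eta f) (vcons_eta f)) minor_vcons.
have [i1 E1] : cintegrable P (fun t => M t v v * minor (M t) g g) /\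
    E (fun t => M t v v * minor (M t) g g) = 0.
  have [|||i1] := @expect_uniq_mono_polynomial (img g)
    [:: (v, v)] (fun t => minor (M t) g g).
  - by [].
  - by move=> k; rewrite inE => /eqP -> /=; rewrite (negbTE W0).
  - by apply: minor_polynomial => // i; exact: imgE.
  by rewrite mono1 in i1 *; rewrite -mono1 mean0 mul0r.
have S k l : cintegrable P (fun t => M t v (g l) * M t (g k) v * cominor (M t) g g k l) /\
    E (fun t => M t v (g l) * M t (g k) v * cominor (M t) g g k l) =
    (k == l)%:R * E (fun t => cominor (M t) g g k l).
  have [|||i2] := @expect_uniq_mono_polynomial (img g)
    [:: (v, g l); (g k, v)] (fun t => cominor (M t) g g k l).
  - by rewrite /= inE xpair_eqE eq_sym (negbTE (gv _)).
  - by move=> j; rewrite !inE => /orP[]/eqP -> /=; rewrite (negbTE W0) ?andbF.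
  - by apply: cominor_polynomial => // i; exact: imgE.
  rewrite expect_border// (inj_eq gI) (eq_sym l).
  by rewrite mono2 in i2 *.
have [i2 E2] := cexpect_sum2 (fun k l => (S k l).1).
have [_ ->] := cexpectB i1 i2; rewrite E1 E2 sub0r; congr (- _).
apply: eq_bigr => k _; rewrite (bigD1 k)//= (S k k).2 eqxx mul1r.
rewrite big1 ?addr0; last by move=> l lk; rewrite (S k l).2 eq_sym (negbTE lk) mul0r.
by congr E; apply/funext => t; rewrite cominorE exprD -expr2 sqrr_sign mul1r.
Qed.

Lemma expect_minor m (f : 'I_m -> 'I_n) : injective f ->
  E (fun t => minor (M t) f f) = mean_det _ m.
Proof.
have [k] := ubnP m; elim: k m f => // k IH [|[|m]] f mk fI.
- under eq_fun do rewrite minor0; rewrite (cexpect_cst P 1).2.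
  by rewrite /mean_det /= !expr0 mul1r mulr1 divr1.
- under eq_fun do rewrite /minor det_mx11 mxE.
  by rewrite /mean_det /=; have := mean0 (f ord0) (f ord0); rewrite mono1.
rewrite expect_minor_step// mean_detSS (eq_bigr (fun=> mean_det _ m)); last first.
  by move=> l _; apply: IH => [|i j /fI/lift_inj/lift_inj//]; lia.
by rewrite sumr_const card_ord mulr_natl.
Qed.

End MinorMoments.

(** The base values are 1 for the empty minor and [beta = E M_ii^2] for size one. Stated over a
    ring, since it is derived in [R[i]] and estimated in [R]. *)
Fixpoint sqr_det (C : pzRingType) (beta : C) (m : nat) : C :=
  if m isn't m1.+1 then 1 else
  if m1 isn't m2.+1 then beta else
  beta * sqr_det beta m1 + m1%:R * (m1%:R + beta) * sqr_det beta m2.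

(** * Second moment of principal minors *)

Section GaussianMinors.
Context {d : measure_display} {T : measurableType d} {R : realType}.
Variables (P : probability T R) (n : nat) (M : T -> 'M[R[i]]_n).
Hypothesis herm : forall t, M t \is hermsymmx.
Hypothesis mM : forall i j, measurable_fun [set: T] (fun t => re_im (M t i j)).
Hypothesis indM : mutually_independent P (fun k : 'I_n * 'I_n => (k.1 <= k.2)%N)
  (fun k t => re_im (M t k.1 k.2)).
Hypothesis adm_all : forall L, admissible P M L.
Local Notation poly W := (polynomial_in P M W).
Local Notation E := (cexpect P).
Local Notation mu L := (E (mono M L)).

Let adm_uniq L : uniq L -> admissible P M L. Proof. by []. Qed.

(** Positions may repeat in a product; this is why admissibility is assumed here for every
    monomial. *)
Lemma polynomialM W G H : poly W G -> poly W H -> poly W (fun t => G t * H t).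
Proof.
move=> [l [lW ->]] [l' [l'W ->]].
exists [seq (p.1 * q.1, p.2 ++ q.2) | p <- l, q <- l']; split => [p|].
  move=> /allpairsP[[q q'] [/= /lW[_ qW] /l'W[_ q'W] ->]]; split => // k /=.
  by rewrite mem_cat => /orP[/qW|/q'W].
apply/funext => t; rewrite big_allpairs_dep mulr_suml.
apply: eq_bigr => p _; rewrite mulr_sumr; apply: eq_bigr => q _ /=.
by rewrite mono_cat mulrACA.
Qed.

Lemma expect_mono_poly W L G : all (fun k => ~~ (W k.1 && W k.2)) L ->
  poly W G -> cintegrable P (fun t => mono M L t * G t) /\
  E (fun t => mono M L t * G t) = mu L * E G.
Proof. by move=> /allP; exact: expect_mono_polynomial. Qed.

(** One expansion for three configurations: the same border twice, two different diagonal borders,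
    and crossed borders. The means [mu] split off because every border position has an index outside
    the image of [f], while the minor and its cofactors stay inside. *)
Lemma expect_minor_vconsM m (f : 'I_m -> 'I_n) v w v' w' : injective f ->
  ~~ img f v -> ~~ img f w -> ~~ img f v' -> ~~ img f w' ->
  E (fun t => minor (M t) (vcons v f) (vcons w f) *
              minor (M t) (vcons v' f) (vcons w' f)) =
  mu [:: (v, w); (v', w')] * E (fun t => minor (M t) f f * minor (M t) f f)
  - \sum_k \sum_l mu [:: (v, w); (v', f l); (f k, w')] *
      E (fun t => minor (M t) f f * cominor (M t) f f k l)
  - \sum_k \sum_l mu [:: (v, f l); (f k, w); (v', w')] *
      E (fun t => cominor (M t) f f k l * minor (M t) f f)
  + \sum_k \sum_l \sum_k' \sum_l'
      mu [:: (v, f l); (f k, w); (v', f l'); (f k', w')] *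
      E (fun t => cominor (M t) f f k l * cominor (M t) f f k' l').
Proof.
move=> fI vf wf v'f w'f.
pose D t := minor (M t) f f; pose C k l t := cominor (M t) f f k l.
have pD : poly (img f) D by apply: minor_polynomial => // i; exact: imgE.
have pC k l : poly (img f) (C k l) by apply: cominor_polynomial => // i; exact: imgE.
pose out L := all (fun k => ~~ (img f k.1 && img f k.2)) L.
have o0 : out [:: (v, w); (v', w')] by rewrite /out /= (negbTE vf) (negbTE v'f).
have o1 k l : out [:: (v, w); (v', f l); (f k, w')].
  by rewrite /out /= (negbTE vf) (negbTE v'f) (negbTE w'f) andbF.
have o2 k l : out [:: (v, f l); (f k, w); (v', w')].
  by rewrite /out /= (negbTE vf) (negbTE wf) (negbTE v'f) andbF.
have o3 k l k' l' : out [:: (v, f l); (f k, w); (v', f l'); (f k', w')].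
  by rewrite /out /= (negbTE vf) (negbTE wf) (negbTE v'f) (negbTE w'f) !andbF.
have [i0 E0] := expect_mono_poly o0 (polynomialM pD pD).
have S1 k l := expect_mono_poly (o1 k l) (polynomialM pD (pC k l)).
have S2 k l := expect_mono_poly (o2 k l) (polynomialM (pC k l) pD).
have S3 k l k' l' :=
  expect_mono_poly (o3 k l k' l') (polynomialM (pC k l) (pC k' l')).
have [i1 E1] := cexpect_sum2 (fun k l => (S1 k l).1).
have [i2 E2] := cexpect_sum2 (fun k l => (S2 k l).1).
have S3' k l := cexpect_sum2 (fun k' l' => (S3 k l k' l').1).
have [i3 E3] := cexpect_sum2 (fun k l => (S3' k l).1).
have [i01 E01] := cexpectB i0 i1.
have [i012 E012] := cexpectB i01 i2.
have [_ E0123] := cexpectD i012 i3.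
transitivity (E (fun t => mono M [:: (v, w); (v', w')] t * (D t * D t) -
    \sum_i \sum_j mono M [:: (v, w); (v', f j); (f i, w')] t * (D t * C i j t) -
    \sum_i \sum_j mono M [:: (v, f j); (f i, w); (v', w')] t * (C i j t * D t) +
    \sum_i \sum_j \sum_i0 \sum_j0
       mono M [:: (v, f j); (f i, w); (v', f j0); (f i0, w')] t *
       (C i j t * C i0 j0 t))).
  congr E; apply/funext => t; rewrite !minor_vcons -/(D t).
  have -> (x s x' s' : R[i]) :
      (x - s) * (x' - s') = x * x' - x * s' - s * x' + s * s' by ring.
  congr (_ - _ - _ + _).
  - by rewrite mono2; ring.
  - rewrite mulr_sumr; apply: eq_bigr => k _; rewrite mulr_sumr.
    by apply: eq_bigr => l _; rewrite /mono !big_cons big_nil /C /=; ring.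
  - rewrite mulr_suml; apply: eq_bigr => k _; rewrite mulr_suml.
    by apply: eq_bigr => l _; rewrite /mono !big_cons big_nil /C /=; ring.
  - rewrite mulr_suml; apply: eq_bigr => k _; rewrite mulr_suml.
    apply: eq_bigr => l _; rewrite mulr_sumr; apply: eq_bigr => k' _.
    rewrite mulr_sumr; apply: eq_bigr => l' _.
    by rewrite /mono !big_cons big_nil /C /=; ring.
rewrite E0123 E012 E01 E0 E1 E2 E3; congr (_ - _ - _ + _).
- by apply: eq_bigr => k _; apply: eq_bigr => l _; rewrite (S1 k l).2.
- by apply: eq_bigr => k _; apply: eq_bigr => l _; rewrite (S2 k l).2.
- apply: eq_bigr => k _; apply: eq_bigr => l _; rewrite (S3' k l).2.
  by apply: eq_bigr => k' _; apply: eq_bigr => l' _; rewrite (S3 k l k' l').2.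
Qed.
(** The value 1 is GUE, with [E M_ij^2 = 0] and [E |M_ij|^4 = 2]; the value 2 is GOE, with real
    entries of variance 1 and fourth moment 3. *)
Variable beta : R[i].
Hypothesis mean0 : forall i j, mu [:: (i, j)] = 0.
Hypothesis diag2 : forall i, mu [:: (i, i); (i, i)] = beta.
Hypothesis off_norm2 : forall i j, i != j -> mu [:: (i, j); (j, i)] = 1.
Hypothesis off_sqr : forall i j, i != j -> mu [:: (i, j); (i, j)] = beta - 1.
Hypothesis off_norm4 : forall i j, i != j ->
  mu [:: (i, j); (j, i); (i, j); (j, i)] = beta + 1.
Hypothesis beta12 : (beta - 1) * (beta - 1) = beta - 1.

Lemma expect_mono_isolated (k : 'I_n * 'I_n) L : all (fun l => upper k != upper l) L ->
  mu (k :: L) = 0.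
Proof.
move=> kL; rewrite -cat1s.
have [||| _ ->] := @expect_mono_cat _ _ _ P n M herm mM indM [:: k] L.
- exact: adm_all.
- exact: adm_all.
- by move=> a b; rewrite inE => /eqP ->; exact: (allP kL).
- by case: k {kL} => i j; rewrite mean0 mul0r.
Qed.

Lemma expect_mono_disjoint (L1 L2 : seq ('I_n * 'I_n)) :
  all (fun k => all (fun l => upper k != upper l) L2) L1 ->
  mu (L1 ++ L2) = mu L1 * mu L2.
Proof.
move=> L12.
have [||| _ ->] // := @expect_mono_cat _ _ _ P n M herm mM indM L1 L2.
by move=> a b aL bL; exact: (allP (allP L12 _ aL)).
Qed.

Lemma upper_eq_star (v a b : 'I_n) : a != v -> b != v ->
  (upper (v, a) == upper (v, b)) = (a == b).
Proof.
move=> av bv; rewrite upper_eq !xpair_eqE /= eqxx (negbTE av) andbF orbF.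
by [].
Qed.

Let mono_eq L1 L2 : mono M L1 = mono M L2 -> mu L1 = mu L2.
Proof. by move=> ->. Qed.

Let mono4 (k1 k2 k3 k4 : 'I_n * 'I_n) t : mono M [:: k1; k2; k3; k4] t =
  M t k1.1 k1.2 * M t k2.1 k2.2 * M t k3.1 k3.2 * M t k4.1 k4.2.
Proof. by rewrite /mono !big_cons big_nil mulr1 !mulrA. Qed.

(** If one of the four indices differs from the other three, its entry occurs alone and both sides
    vanish. Two distinct pairs give one of the three pairings, the last as [(beta - 1)^2], which
    [beta12] reduces. If all four agree, the fourth moment is the sum of all pairings,
    [1 + 1 + (beta - 1)]. *)
Lemma expect_wick v a b c e : a != v -> b != v -> c != v -> e != v ->
  mu [:: (v, a); (b, v); (v, c); (e, v)] =
  (a == b)%:R * (c == e)%:R + (a == e)%:R * (c == b)%:R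
  + (beta - 1) * ((a == c)%:R * (b == e)%:R).
Proof.
move=> av bv cv ev.
have iso1 : a != b -> a != c -> a != e -> mu [:: (v, a); (b, v); (v, c); (e, v)] = 0.
  move=> ab ac ae; apply: expect_mono_isolated.
  by rewrite /= [upper (b, v)]upper_swap [upper (e, v)]upper_swap !upper_eq_star// ab ac ae.
have iso2 : b != a -> b != c -> b != e -> mu [:: (v, a); (b, v); (v, c); (e, v)] = 0.
  move=> ba bc be.
  rewrite (mono_eq (L2 := [:: (b, v); (v, a); (v, c); (e, v)])); last first.
    by apply/funext => t; rewrite !mono4 /=; ring.
  apply: expect_mono_isolated.
  by rewrite /= [upper (b, v)]upper_swap [upper (e, v)]upper_swap !upper_eq_star// ba bc be.
have iso3 : c != a -> c != b -> c != e -> mu [:: (v, a); (b, v); (v, c); (e, v)] = 0.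
  move=> ca cb ce.
  rewrite (mono_eq (L2 := [:: (v, c); (v, a); (b, v); (e, v)])); last first.
    by apply/funext => t; rewrite !mono4 /=; ring.
  apply: expect_mono_isolated.
  by rewrite /= [upper (b, v)]upper_swap [upper (e, v)]upper_swap !upper_eq_star// ca cb ce.
have iso4 : e != a -> e != b -> e != c -> mu [:: (v, a); (b, v); (v, c); (e, v)] = 0.
  move=> ea eb ec.
  rewrite (mono_eq (L2 := [:: (e, v); (v, a); (b, v); (v, c)])); last first.
    by apply/funext => t; rewrite !mono4 /=; ring.
  apply: expect_mono_isolated.
  by rewrite /= [upper (b, v)]upper_swap [upper (e, v)]upper_swap !upper_eq_star// ea eb ec.
have [ab|ab] := eqVneq a b.
  subst b; have [ce|ce] := eqVneq c e.
    subst e; have [ac|ac] := eqVneq a c.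
      subst c; rewrite off_norm4 1?eq_sym// ?eqxx. rewrite /=; ring.
    have := @expect_mono_disjoint [:: (v, a); (a, v)] [:: (v, c); (c, v)].
    rewrite /= [upper (a, v)]upper_swap [upper (c, v)]upper_swap !upper_eq_star// ac.
    move=> /(_ isT) ->; rewrite !off_norm2 1?eq_sym//.
    rewrite /=; ring.
  have [ac|ac] := eqVneq a c.
    by subst c; rewrite iso4 ?(eq_sym e)// ?(negbTE ce); rewrite /=; ring.
  have ca : c != a by rewrite eq_sym.
  rewrite iso3//; have [ae|ae] := eqVneq a e; last by rewrite /=; ring.
  by rewrite /=; ring.
have [ae|ae] := eqVneq a e.
  subst e; have [cb|cb] := eqVneq c b.
    subst c; rewrite (mono_eq (L2 := [:: (v, a); (a, v)] ++ [:: (v, b); (b, v)])); last first.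
      by apply/funext => t; rewrite !mono4 /=; ring.
    rewrite expect_mono_disjoint; last first.
      by rewrite /= [upper (a, v)]upper_swap [upper (b, v)]upper_swap !upper_eq_star// ab.
    by rewrite !off_norm2 1?eq_sym// ?(negbTE ab); rewrite /=; ring.
  have ba : b != a by rewrite eq_sym.
  by rewrite iso2// 1?eq_sym// ?(negbTE ba); rewrite /=; ring.
have [ac|ac] := eqVneq a c; last by rewrite iso1//; rewrite /=; ring.
subst c; have [be|be] := eqVneq b e; last first.
  by rewrite iso2// 1?eq_sym// ?(negbTE ab); rewrite /=; ring.
subst e; rewrite (mono_eq (L2 := [:: (v, a); (v, a)] ++ [:: (b, v); (b, v)])); last first.
  by apply/funext => t; rewrite !mono4 /=; ring.
rewrite expect_mono_disjoint; last first.
  by rewrite /= [upper (b, v)]upper_swap !upper_eq_star// ab.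
by rewrite !off_sqr// 1?eq_sym// beta12; rewrite /=; ring.
Qed.

(** For [beta = 1] both sides are 0; for [beta = 2] the matrix is almost surely symmetric and so are
    its cofactors. *)
Hypothesis cominor_sym : forall m (f : 'I_m -> 'I_n) k l, injective f ->
  (beta - 1) * E (fun t => cominor (M t) f f k l * cominor (M t) f f k l) =
  (beta - 1) * E (fun t => cominor (M t) f f k l * cominor (M t) f f l k).

Let img_neq m (f : 'I_m -> 'I_n) v i : ~~ img f v -> f i != v.
Proof. by move=> fv; apply: contraNneq fv => <-; exact: imgE. Qed.

Let sum2_0 m : \sum_(k < m) \sum_(l < m) (0 : R[i]) = 0.
Proof. by rewrite big1// => k _; rewrite big1. Qed.

Let upper_diag_neq (v a b : 'I_n) : a != v -> upper (v, v) != upper (a, b).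
Proof. by move=> av; rewrite upper_eq !xpair_eqE /= !(eq_sym v) (negbTE av) /= andbF. Qed.

Let upper_diag_neq' (v a b : 'I_n) : b != v -> upper (v, v) != upper (a, b).
Proof. by move=> bv; rewrite (upper_swap a) upper_diag_neq. Qed.

Lemma expect_minor_sqr_step m (f : 'I_m -> 'I_n) v : injective f -> ~~ img f v ->
  E (fun t => minor (M t) (vcons v f) (vcons v f) * minor (M t) (vcons v f) (vcons v f)) =
  beta * E (fun t => minor (M t) f f * minor (M t) f f) +
  \sum_k \sum_l (E (fun t => cominor (M t) f f k k * cominor (M t) f f l l) +
     beta * E (fun t => cominor (M t) f f k l * cominor (M t) f f l k)).
Proof.
move=> fI vf; have fv i := img_neq i vf.
have z1 k l : mu [:: (v, v); (v, f l); (f k, v)] = 0.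
  by rewrite expect_mono_isolated//= upper_diag_neq' // upper_diag_neq.
have z2 k l : mu [:: (v, f l); (f k, v); (v, v)] = 0.
  rewrite (mono_eq (L2 := [:: (v, v); (v, f l); (f k, v)])) ?z1//.
  by apply/funext => t; rewrite /mono !big_cons big_nil /=; ring.
rewrite expect_minor_vconsM// diag2.
under [X in _ - X - _ + _]eq_bigr do under eq_bigr do rewrite z1 mul0r.
under [X in _ - X + _]eq_bigr do under eq_bigr do rewrite z2 mul0r.
rewrite !sum2_0.
rewrite !subr0; congr (_ + _).
pose G k l k' l' := E (fun t => cominor (M t) f f k l * cominor (M t) f f k' l').
transitivity (\sum_k \sum_l \sum_k' \sum_l'
    ((l == k)%:R * (l' == k')%:R + (l == k')%:R * (l' == k)%:R
     + (beta - 1) * ((l' == l)%:R * (k' == k)%:R)) * G k l k' l').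
  apply: eq_bigr => k _; apply: eq_bigr => l _.
  apply: eq_bigr => k' _; apply: eq_bigr => l' _.
  by rewrite expect_wick// !(inj_eq fI) (eq_sym l l') (eq_sym k k').
rewrite (sum_wick G); apply: eq_bigr => k _; apply: eq_bigr => l _.
(* The third pairing merges with the second, and the weights 1 and [beta - 1] add up to [beta]. *)
by rewrite -addrA /G cominor_sym// mulrBl mul1r; congr (_ + _); rewrite addrC subrK.
Qed.

(** The borders at [v] and at [w] consist of different independent entries, so that only the
    pairings within each border survive. The diagonal entries [M_vv] and [M_ww] occur once and
    contribute nothing. *)
Lemma expect_minor_border_diag m (f : 'I_m -> 'I_n) v w : injective f ->
  ~~ img f v -> ~~ img f w -> v != w ->
  E (fun t => minor (M t) (vcons v f) (vcons v f) * minor (M t) (vcons w f) (vcons w f)) =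
  \sum_k \sum_l E (fun t => cominor (M t) f f k k * cominor (M t) f f l l).
Proof.
move=> fI vf wf vw; have fv i := img_neq i vf; have fw i := img_neq i wf.
have wv : w != v by rewrite eq_sym.
have z0 : mu [:: (v, v); (w, w)] = 0.
  by rewrite expect_mono_isolated//= upper_diag_neq.
have z1 k l : mu [:: (v, v); (w, f l); (f k, w)] = 0.
  by rewrite expect_mono_isolated//= upper_diag_neq // upper_diag_neq.
have z2 k l : mu [:: (v, f l); (f k, v); (w, w)] = 0.
  rewrite (mono_eq (L2 := [:: (w, w); (v, f l); (f k, v)])).
    by rewrite expect_mono_isolated//= upper_diag_neq // upper_diag_neq.
  by apply/funext => t; rewrite /mono !big_cons big_nil /=; ring.
have z3 k l k' l' : mu [:: (v, f l); (f k, v); (w, f l'); (f k', w)] =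
    (l == k)%:R * (l' == k')%:R.
  rewrite (@expect_mono_disjoint [:: (v, f l); (f k, v)] [:: (w, f l'); (f k', w)]).
    by rewrite !(expect_border herm mM indM adm_uniq mean0 off_norm2)// !(inj_eq fI).
  rewrite /= !upper_eq !xpair_eqE /= ?(eq_sym v (f _), eq_sym w (f _)) ?(negbTE vw) ?(negbTE wv).
  by rewrite !(negbTE (fv _), negbTE (fw _)) ?andbF.
rewrite expect_minor_vconsM// z0 mul0r.
under [X in _ - X - _ + _]eq_bigr do under eq_bigr do rewrite z1 mul0r.
under [X in _ - X + _]eq_bigr do under eq_bigr do rewrite z2 mul0r.
rewrite !sum2_0 !subr0 add0r; apply: eq_bigr => k _.
pose G k l k' l' := E (fun t => cominor (M t) f f k l * cominor (M t) f f k' l').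
transitivity (\sum_l (l == k)%:R * \sum_k' G k l k' k').
  apply: eq_bigr => l _; rewrite mulr_sumr; apply: eq_bigr => k' _.
  under eq_bigr do rewrite z3 -mulrA.
  by rewrite -mulr_sumr (sum_delta (fun j => G k l k' j)).
exact: (sum_delta (fun l => \sum_k' G k l k' k')).
Qed.

(** [M_vw] from one minor meets its conjugate [M_wv] from the other, whence the first term. Among
    the remaining entries, those at [v] pair across the two minors, and so do those at [w], which
    turns [C_kl C_k'l'] into [C_kl C_lk]. *)
Lemma expect_minor_border_cross m (f : 'I_m -> 'I_n) v w : injective f ->
  ~~ img f v -> ~~ img f w -> v != w ->
  E (fun t => minor (M t) (vcons v f) (vcons w f) * minor (M t) (vcons w f) (vcons v f)) =
  E (fun t => minor (M t) f f * minor (M t) f f) +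
  \sum_k \sum_l E (fun t => cominor (M t) f f k l * cominor (M t) f f l k).
Proof.
move=> fI vf wf vw; have fv i := img_neq i vf; have fw i := img_neq i wf.
have wv : w != v by rewrite eq_sym.
have z1 k l : mu [:: (v, w); (w, f l); (f k, v)] = 0.
  rewrite expect_mono_isolated//= !upper_eq !xpair_eqE /= ?(eq_sym v (f _), eq_sym w (f _)).
  by rewrite ?(negbTE vw) ?(negbTE wv) !(negbTE (fv _), negbTE (fw _)) ?andbF.
have z2 k l : mu [:: (v, f l); (f k, w); (w, v)] = 0.
  rewrite (mono_eq (L2 := [:: (w, v); (v, f l); (f k, w)])).
    rewrite expect_mono_isolated//= !upper_eq !xpair_eqE /= ?(eq_sym v (f _), eq_sym w (f _)).
    by rewrite ?(negbTE vw) ?(negbTE wv) !(negbTE (fv _), negbTE (fw _)) ?andbF.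
  by apply/funext => t; rewrite /mono !big_cons big_nil /=; ring.
have z3 k l k' l' : mu [:: (v, f l); (f k, w); (w, f l'); (f k', v)] =
    (k' == l)%:R * (l' == k)%:R.
  rewrite (mono_eq (L2 := [:: (v, f l); (f k', v)] ++ [:: (w, f l'); (f k, w)])).
    rewrite (@expect_mono_disjoint [:: (v, f l); (f k', v)] [:: (w, f l'); (f k, w)]).
      rewrite !(expect_border herm mM indM adm_uniq mean0 off_norm2)// !(inj_eq fI).
      by rewrite (eq_sym l).
    rewrite /= !upper_eq !xpair_eqE /= ?(eq_sym v (f _), eq_sym w (f _)) ?(negbTE vw) ?(negbTE wv).
    by rewrite !(negbTE (fv _), negbTE (fw _)) ?andbF.
  by apply/funext => t; rewrite !mono4 /=; ring.
rewrite expect_minor_vconsM// off_norm2// mul1r.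
under [X in _ - X - _ + _]eq_bigr do under eq_bigr do rewrite z1 mul0r.
under [X in _ - X + _]eq_bigr do under eq_bigr do rewrite z2 mul0r.
rewrite !sum2_0 !subr0; congr (_ + _).
apply: eq_bigr => k _; apply: eq_bigr => l _.
pose G k l k' l' := E (fun t => cominor (M t) f f k l * cominor (M t) f f k' l').
transitivity (\sum_k' (k' == l)%:R * \sum_l' (l' == k)%:R * G k l k' l').
  apply: eq_bigr => k' _; rewrite mulr_sumr; apply: eq_bigr => l' _.
  by rewrite z3 -mulrA.
rewrite (sum_delta (fun k' => \sum_l' (l' == k)%:R * G k l k' l')).
exact: (sum_delta (fun l' => G k l l l')).
Qed.

(** Both sides expand into the same sums: the term with the squared minor of [f] comes from
    [M_vw M_wv], weighted by [beta], on the left and from [M_vv^2], of mean [beta], on the right. *)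
Lemma expect_minor_rotation m (f : 'I_m -> 'I_n) v w : injective f ->
  ~~ img f v -> ~~ img f w -> v != w ->
  E (fun t => minor (M t) (vcons v f) (vcons v f) * minor (M t) (vcons w f) (vcons w f)) +
  beta * E (fun t => minor (M t) (vcons v f) (vcons w f) * minor (M t) (vcons w f) (vcons v f)) =
  E (fun t => minor (M t) (vcons v f) (vcons v f) * minor (M t) (vcons v f) (vcons v f)).
Proof.
move=> fI vf wf vw; rewrite expect_minor_border_diag// expect_minor_border_cross//.
rewrite expect_minor_sqr_step// mulrDr addrCA; congr (_ + _).
rewrite mulr_sumr -big_split; apply: eq_bigr => k _ /=.
by rewrite mulr_sumr -big_split.
Qed.

(** Reordering the lists multiplies minors by signs; in each of the three products every sign occurs
    twice. *)
Lemma expect_minor_rotation_perm m (g : 'I_m -> 'I_n) v w (p q : 'I_m.+1 -> 'I_n) :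
  injective g -> ~~ img g v -> ~~ img g w -> v != w ->
  injective p -> (forall i, exists j, p i = vcons v g j) ->
  injective q -> (forall i, exists j, q i = vcons w g j) ->
  E (fun t => minor (M t) p p * minor (M t) q q) +
  beta * E (fun t => minor (M t) p q * minor (M t) q p) =
  E (fun t => minor (M t) p p * minor (M t) p p).
Proof.
move=> gI vg wg vw pI pv qI qw.
have gv i := img_neq i vg; have gw i := img_neq i wg.
have [s ps] := inj_same_image (vcons_inj gI gv) pI pv.
have [r qr] := inj_same_image (vcons_inj gI gw) qI qw.
have := expect_minor_rotation gI vg wg vw.
have sgn2 (b : bool) : (-1) ^+ b * (-1) ^+ b = 1 :> R[i] by rewrite -expr2 sqrr_sign.
have signs (x y : bool) (a b : R[i]) :
    (-1) ^+ x * (-1) ^+ y * a * ((-1) ^+ y * (-1) ^+ x * b) = a * b.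
  by rewrite (_ : _ * _ = ((-1) ^+ x * (-1) ^+ x) * ((-1) ^+ y * (-1) ^+ y) * (a * b));
    [rewrite !sgn2 !mul1r|ring].
have pp t : minor (M t) p p = minor (M t) (vcons v g) (vcons v g).
  by rewrite (eq_minor _ ps ps) minor_perm sgn2 mul1r.
have qq t : minor (M t) q q = minor (M t) (vcons w g) (vcons w g).
  by rewrite (eq_minor _ qr qr) minor_perm sgn2 mul1r.
have pq t : minor (M t) p q * minor (M t) q p =
    minor (M t) (vcons v g) (vcons w g) * minor (M t) (vcons w g) (vcons v g).
  by rewrite (eq_minor _ ps qr) (eq_minor _ qr ps) !minor_perm signs.
under [X in E X + _ = _ -> _]eq_fun do rewrite -pp -qq.
under [X in _ + _ * E X = _ -> _]eq_fun do rewrite -pq.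
by under [X in _ = E X -> _]eq_fun do rewrite -pp.
Qed.

Lemma expect_minor_rotation_lift m (f : 'I_m.+1 -> 'I_n) k l : injective f -> k != l ->
  E (fun t => minor (M t) (f \o lift k) (f \o lift k) * minor (M t) (f \o lift l) (f \o lift l)) +
  beta * E (fun t => minor (M t) (f \o lift k) (f \o lift l) *
    minor (M t) (f \o lift l) (f \o lift k)) =
  E (fun t => minor (M t) (f \o lift k) (f \o lift k) * minor (M t) (f \o lift k) (f \o lift k)).
Proof.
case: m f k l => [f k l _|m f k l fI kl]; first by rewrite !ord1.
have [j lE|] := unliftP k l; last by move=> lk; rewrite lk eqxx in kl.
(* [g] omits both [k] and [l]. The list without [k] is then [g] with [f l] added, the list without
   [l] is [g] with [f k] added, up to order. *)
pose g := f \o lift k \o lift j.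
have gI : injective g by move=> a b /fI/lift_inj/lift_inj.
have out (v : 'I_m.+2) : (forall i, lift k (lift j i) != v) -> ~~ img g (f v).
  by move=> nv; apply: img_notin => i; apply: contraNneq (nv i) => /fI ->.
apply: (@expect_minor_rotation_perm m g (f l) (f k)) => //.
- by apply: out => i; rewrite lE (inj_eq lift_inj) eq_sym neq_lift.
- by apply: out => i; rewrite eq_sym neq_lift.
- by rewrite (inj_eq fI) eq_sym.
- by move=> a b /fI/lift_inj.
- move=> i; have [i' ->|->] := unliftP j i.
    by exists (lift ord0 i'); rewrite vcons_lift.
  by exists ord0; rewrite vcons0 /= lE.
- by move=> a b /fI/lift_inj.
- move=> i /=; have [y yE|->] := unliftP k (lift l i); last first.
    by exists ord0; rewrite vcons0.
  have [z zE|yj] := unliftP j y.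
    by exists (lift ord0 z); rewrite vcons_lift yE zE.
  by have := neq_lift l i; rewrite yE yj -lE eqxx.
Qed.

Lemma expect_minor_sqr_rec m (f : 'I_m.+2 -> 'I_n) : injective f ->
  E (fun t => minor (M t) f f * minor (M t) f f) =
  beta * E (fun t => minor (M t) (f \o lift ord0) (f \o lift ord0)
                   * minor (M t) (f \o lift ord0) (f \o lift ord0)) +
  \sum_(k < m.+1) (beta + m.+1%:R) *
    E (fun t => minor (M t) (f \o lift ord0 \o lift k) (f \o lift ord0 \o lift k)
              * minor (M t) (f \o lift ord0 \o lift k) (f \o lift ord0 \o lift k)).
Proof.
move=> fI; pose v := f ord0; pose g := f \o lift ord0.
have gI : injective g by move=> i j /fI/lift_inj.
have gv : ~~ img g v.
  by apply: img_notin => i; apply/eqP => /fI/eqP; rewrite eq_sym (negbTE (neq_lift _ _)).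
under eq_fun do rewrite (eq_minor _ (vcons_eta f) (vcons_eta f)).
rewrite expect_minor_sqr_step// -/g; congr (_ + _); apply: eq_bigr => k _.
pose U k := E (fun t => minor (M t) (g \o lift k) (g \o lift k)
                      * minor (M t) (g \o lift k) (g \o lift k)).
have even (a : nat) : (-1) ^+ (a + a) = 1 :> R[i] by rewrite exprD -expr2 sqrr_sign.
have cdiag l t : cominor (M t) g g k k * cominor (M t) g g l l =
    minor (M t) (g \o lift k) (g \o lift k) * minor (M t) (g \o lift l) (g \o lift l).
  by rewrite !cominorE !even !mul1r.
have ccross l t : cominor (M t) g g k l * cominor (M t) g g l k =
    minor (M t) (g \o lift k) (g \o lift l) * minor (M t) (g \o lift l) (g \o lift k).
  by rewrite !cominorE mulrACA -exprD (addnC l) even mul1r.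
(* For fixed [k] the term [l = k] is [(beta + 1) U k], and the rotation identity makes each of the
   [m] other terms equal to [U k], in total [(beta + m + 1) U k]. *)
have step l : E (fun t => cominor (M t) g g k k * cominor (M t) g g l l) +
    beta * E (fun t => cominor (M t) g g k l * cominor (M t) g g l k) =
    (if l == k then beta + 1 else 1) * U k.
  under eq_fun do rewrite cdiag; under [in X in _ + X]eq_fun do rewrite ccross.
  have [->|lk] := eqVneq l k; first by rewrite -/(U k); ring.
  by rewrite mul1r expect_minor_rotation_lift// eq_sym.
rewrite (eq_bigr _ (fun l _ => step l)) (bigD1 k)//= eqxx.
rewrite (eq_bigr (fun=> U k)); last by move=> l /negbTE->; rewrite mul1r.
rewrite sumr_const cardC1 card_ord /= -[U k *+ m]mulr_natl -mulrDl.
by congr (_ * _); rewrite -addrA nat1r.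
Qed.

Lemma expect_minor_sqr m (f : 'I_m -> 'I_n) : injective f ->
  E (fun t => minor (M t) f f * minor (M t) f f) = sqr_det beta m.
Proof.
have [k] := ubnP m; elim: k m f => // k IH [|[|m]] f mk fI.
- under eq_fun do rewrite minor0 mulr1; exact: (cexpect_cst P 1).2.
- under eq_fun do rewrite /minor det_mx11 mxE.
  by have := diag2 (f ord0); rewrite mono2.
rewrite expect_minor_sqr_rec// IH; [|lia|by move=> i j /fI/lift_inj].
rewrite (eq_bigr (fun=> (beta + m.+1%:R) * sqr_det beta m)); last first.
  by move=> l _; rewrite IH//; [lia|move=> i j /fI/lift_inj/lift_inj].
rewrite sumr_const card_ord /=; congr (_ + _).
by rewrite -[LHS]mulr_natl mulrA [beta + _]addrC.
Qed.

End GaussianMinors.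

(** * Solution of the recursion and its growth *)

Section CentralBinomial.
Variable R : realType.

Lemma natr_double m : [/\ (m.*2)%:R = 2 * m%:R :> R,
  (m.*2).+1%:R = 2 * m%:R + 1 :> R, (m.*2).+2%:R = 2 * m%:R + 2 :> R &
  (m.*2).+3%:R = 2 * m%:R + 3 :> R].
Proof.
have e : (m.*2)%:R = 2 * m%:R :> R by rewrite -muln2 natrM mulrC.
by rewrite -e; split=> //; rewrite -(natrD _ _ 1, natrD _ _ 2, natrD _ _ 3) ?addn1 ?addn2 ?addn3.
Qed.

(* central m = 'C(2m, m) / 4^m *)
Fixpoint central (m : nat) : R :=
  if m isn't k.+1 then 1 else central k * ((2 * k%:R + 1) / (2 * k%:R + 2)).

Lemma central_gt0 m : 0 < central m.
Proof. by elim: m => //= k IH; rewrite mulr_gt0// divr_gt0// ltr_wpDl. Qed.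

Lemma central_fact m :
  central m = (m.*2)`!%:R / (m`!%:R ^+ 2 * 4 ^+ m).
Proof.
elim: m => [|m IH]; first by rewrite /= expr0 mulr1 expr1n divr1.
have [_ d1 d2 _] := natr_double m.
rewrite [LHS]/= {}IH doubleS !factS !natrM [4 ^+ _.+1]exprS d1 d2 -(natr1 m).
have m0 : m`!%:R != 0 :> R by rewrite pnatr_eq0 -lt0n fact_gt0.
have m1 : 0 <= m%:R :> R by [].
have p4 : 4 ^+ m != 0 :> R by rewrite expf_neq0// pnatr_eq0.
field; rewrite m0 p4 /= !gt_eqF//; lra.
Qed.

(** The product [3 * 5 ... (2m+1) / (2 * 4 ... (2m))], of order [sqrt m]. *)
Definition odd_central m := (2 * m%:R + 1) * central m.

Lemma odd_centralS m :
  odd_central m.+1 = odd_central m * ((2 * m%:R + 3) / (2 * m%:R + 2)).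
Proof.
rewrite /odd_central /= -(natr1 m); have m1 : 0 <= m%:R :> R by [].
by field; rewrite gt_eqF//; lra.
Qed.

Lemma odd_central_gt0 m : 0 < odd_central m.
Proof. by rewrite mulr_gt0 ?central_gt0// ltr_wpDl. Qed.

(** The square of the ratio [(2m+3)/(2m+2)] lies between [(m+2)/(m+1)] and [(2m+3)/(2m+1)], the
    growth factors of the two bounds. *)
Lemma odd_central_bounds m :
  m%:R + 1 <= odd_central m ^+ 2 <= 2 * m%:R + 1.
Proof.
elim: m => [|m /andP[IH1 IH2]].
  by rewrite /odd_central /= mulr0 !add0r mulr1 expr1n lexx.
rewrite odd_centralS exprMn -(natr1 m); have m1 : 0 <= m%:R :> R by [].
set x := m%:R in m1 IH1 IH2 *.
have x2 : 0 < (2 * x + 2) ^+ 2 by rewrite exprn_gt0//; lra.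
rewrite expr_div_n mulrA; apply/andP; split.
- by rewrite ler_pdivlMr//; nra.
- rewrite ler_pdivrMr//.
  apply: (@le_trans _ _ ((2 * x + 1) * (2 * x + 3) ^+ 2)); last by nra.
  by rewrite ler_wpM2r// sqr_ge0.
Qed.

(** With [a_n = u_n / n!] the recursion reads [(n+1) a_(n+1) = a_n + (n+1) a_(n-1)]. Its solution is
    constant from [2m] to [2m + 1], hence the induction over such pairs. *)
Lemma sqr_det1E m :
  sqr_det 1 (m.*2) = (m.*2)`!%:R * odd_central m /\
  sqr_det 1 (m.*2).+1 = (m.*2).+1`!%:R * odd_central m.
Proof.
elim: m => [|m [IH1 IH2]].
  by rewrite /= /odd_central /= mulr0 add0r !mulr1.
have m1 : 0 <= m%:R :> R by [].
have [_ d1 d2 d3] := natr_double m.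
have e1 : sqr_det 1 m.+1.*2 = (m.+1.*2)`!%:R * odd_central m.+1.
  rewrite doubleS; rewrite [LHS](_ : _ = 1 * sqr_det 1 (m.*2).+1 +
    (m.*2).+1%:R * ((m.*2).+1%:R + 1) * sqr_det 1 m.*2)//.
  rewrite IH1 IH2 odd_centralS !factS !natrM ?d3 ?d2 d1 -?(natr1 m).
  by field; rewrite gt_eqF//; lra.
split=> //; rewrite [LHS](_ : _ = 1 * sqr_det 1 m.+1.*2 +
    (m.*2).+2%:R * ((m.*2).+2%:R + 1) * sqr_det 1 (m.*2).+1)//.
rewrite e1 IH2 doubleS odd_centralS !factS !natrM ?d3 ?d2 d1 -?(natr1 m).
by field; rewrite gt_eqF//; lra.
Qed.

(** Now [(n+1) a_(n+1) = 2 a_n + (n+2) a_(n-1)]. The additional factor linear in [m] accounts for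
    the exponent 3/2 in place of 1/2. *)
Lemma sqr_det2E m :
  sqr_det 2 (m.*2) = (m.*2)`!%:R * (odd_central m * ((4 * m%:R + 3) / 3)) /\
  sqr_det 2 (m.*2).+1 = (m.*2).+1`!%:R * (odd_central m * ((4 * m%:R + 6) / 3)).
Proof.
elim: m => [|m [IH1 IH2]].
  rewrite /odd_central /= factS fact0; rewrite muln1; split; first by field.
  by rewrite (_ : (0.*2).+1%:R = 1 :> R)//; field.
have m1 : 0 <= m%:R :> R by [].
have [_ d1 d2 d3] := natr_double m.
have e1 : sqr_det 2 m.+1.*2 =
    (m.+1.*2)`!%:R * (odd_central m.+1 * ((4 * m.+1%:R + 3) / 3)).
  rewrite doubleS; rewrite [LHS](_ : _ = 2 * sqr_det 2 (m.*2).+1 +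
    (m.*2).+1%:R * ((m.*2).+1%:R + 2) * sqr_det 2 m.*2)//.
  rewrite IH1 IH2 odd_centralS !factS !natrM ?d3 ?d2 d1 -?(natr1 m).
  by field; rewrite gt_eqF//; lra.
split=> //; rewrite [LHS](_ : _ = 2 * sqr_det 2 m.+1.*2 +
    (m.*2).+2%:R * ((m.*2).+2%:R + 2) * sqr_det 2 (m.*2).+1)//.
rewrite e1 IH2 doubleS odd_centralS !factS !natrM ?d3 ?d2 d1 -?(natr1 m).
by field; rewrite gt_eqF//; lra.
Qed.

Lemma odd_central_sqrt n : (0 < n)%N ->
  Num.sqrt n%:R / 2 <= odd_central n./2 <= 2 * Num.sqrt n%:R.
Proof.
move=> n0; have /andP[b1 b2] := odd_central_bounds n./2.
have z0 := ltW (odd_central_gt0 n./2).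
have s0 : 0 <= Num.sqrt n%:R :> R by exact: sqrtr_ge0.
have s2 : Num.sqrt n%:R ^+ 2 = n%:R :> R by rewrite sqr_sqrtr.
have nE : n%:R = (odd n)%:R + 2 * (n./2)%:R :> R.
  by rewrite -{1}(odd_double_half n) natrD -muln2 natrM mulrC.
have n1 : 1 <= n%:R :> R by rewrite ler1n.
have o0 : 0 <= (odd n)%:R :> R by [].
have o1 : (odd n)%:R <= 1 :> R by rewrite lern1 leq_b1.
have sq (x y : R) : 0 <= x -> 0 <= y -> x ^+ 2 <= y ^+ 2 -> x <= y.
  by move=> x0 y0; rewrite ler_sqr.
have h0 : 0 <= Num.sqrt n%:R / 2 :> R by rewrite mulr_ge0// invr_ge0.
have d0 : 0 <= 2 * Num.sqrt n%:R :> R by rewrite mulr_ge0.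
have hE : (Num.sqrt n%:R / 2) ^+ 2 = n%:R / 4 :> R.
  by rewrite expr_div_n s2; congr (_ / _); ring.
have dE : (2 * Num.sqrt n%:R) ^+ 2 = 4 * n%:R :> R.
  by rewrite exprMn s2; congr (_ * _); ring.
apply/andP; split.
- by apply: (sq _ _ h0 z0); rewrite hE; apply: le_trans b1; rewrite nE; lra.
- by apply: (sq _ _ z0 d0); rewrite dE; apply: (le_trans b2); rewrite nE in n1 *; lra.
Qed.

Lemma sqr_det1_bounds n : (0 < n)%N ->
  2^-1 * (n%:R `^ (1 / 2) * n`!%:R) <= sqr_det (1 : R) n
    <= 2 * (n%:R `^ (1 / 2) * n`!%:R).
Proof.
move=> n0; have /andP[b1 b2] := odd_central_sqrt n0.
have -> : sqr_det 1 n = n`!%:R * odd_central n./2.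
  rewrite -{1 2}(odd_double_half n); have [e1 e2] := sqr_det1E n./2.
  by case: (odd n); rewrite ?add1n ?add0n.
rewrite div1r powR12_sqrt//.
have f0 : 0 <= n`!%:R :> R by [].
by apply/andP; split; nra.
Qed.

Lemma sqr_det2_bounds n : (0 < n)%N ->
  3^-1 * (n%:R `^ (3 / 2) * n`!%:R) <= sqr_det (2 : R) n
    <= 4 * (n%:R `^ (3 / 2) * n`!%:R).
Proof.
move=> n0; have /andP[b1 b2] := odd_central_sqrt n0.
(* [a] is the linear factor of [sqr_det2E], bounded alike for both parities. Together with
   [odd_central_sqrt] this yields the constants [1/3 = 1/2 * 2/3] and [4 = 2 * 2]. *)
have [a [aE a1 a2]] : exists a : R, [/\
    sqr_det 2 n = n`!%:R * (odd_central n./2 * a), 2 / 3 * n%:R <= a & a <= 2 * n%:R].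
  have nE : n%:R = (odd n)%:R + 2 * (n./2)%:R :> R.
    by rewrite -{1}(odd_double_half n) natrD -muln2 natrM mulrC.
  have n1 : 1 <= n%:R :> R by rewrite ler1n.
  have [e1 e2] := sqr_det2E n./2.
  have := odd_double_half n; case: (odd n) nE => /= nE dE.
    exists ((4 * (n./2)%:R + 6) / 3); split; [by rewrite -{1 2}dE add1n|lra|lra].
  by exists ((4 * (n./2)%:R + 3) / 3); split; [rewrite -{1 2}dE add0n|lra|lra].
rewrite aE (_ : 3 / 2 = 1 + 2^-1); last by field.
rewrite powRD; last by apply/implyP => _; rewrite pnatr_eq0 -lt0n.
rewrite powRr1// powR12_sqrt//.
have f0 : 0 <= n`!%:R :> R by [].
have nn0 : 0 <= n%:R :> R by [].
have s0 : 0 <= Num.sqrt n%:R :> R by exact: sqrtr_ge0.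
have z0 := ltW (odd_central_gt0 n./2).
have p1 : 3^-1 * (n%:R * Num.sqrt n%:R) <= odd_central n./2 * a.
  apply: (@le_trans _ _ (Num.sqrt n%:R / 2 * (2 / 3 * n%:R))); first by nra.
  by apply: ler_pM => //; lra.
have p2 : odd_central n./2 * a <= 4 * (n%:R * Num.sqrt n%:R).
  apply: (@le_trans _ _ (2 * Num.sqrt n%:R * (2 * n%:R))); last by nra.
  by apply: ler_pM => //; nra.
by apply/andP; split; nra.
Qed.

End CentralBinomial.

(** * Wallis' product and the asymptotics of the first moment *)

Section Wallis.
Variable R : realType.
Let mu : {measure set (measurableTypeR R) -> \bar R} := lebesgue_measure.
Local Notation J n := (Rintegral mu `[0, pi / 2] (fun x : R => sin x ^+ n)).

Let pi2_gt0 : 0 < pi / 2 :> R.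
Proof. exact: lt_le_trans ltr01 (pihalf_ge1 R). Qed.

Let integrable_cont (f : R -> R) : continuous f -> mu.-integrable `[0, pi / 2] (EFin \o f).
Proof.
move=> cf; apply: continuous_compact_integrable; first exact: segment_compact.
exact: continuous_subspaceT.
Qed.

Let cont_sinX n : continuous (fun x : R => sin x ^+ n).
Proof.
move=> x; apply: (@continuous_comp _ _ _ (@sin R) (fun y => y ^+ n)).
  exact: continuous_sin.
exact: exprn_continuous.
Qed.

Lemma Rintegral_sinX0 : J 0 = pi / 2.
Proof.
rewrite (_ : (fun _ => _) = cst (1 : R)); last by apply/funext => x /=; rewrite expr0.
rewrite Rintegral_cst// mul1r.
have := lebesgue_measure_itv (`[0%R, (pi / 2)%R] : interval R).
by rewrite /= lte_fin pi2_gt0 sube0 /mu => ->.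
Qed.

Lemma Rintegral_FTC (f F : R -> R) : continuous f ->
  (forall x : R, is_derive x (1 : R) F (f x)) ->
  Rintegral mu `[0, pi / 2] f = F (pi / 2) - F 0.
Proof.
move=> cf dF; rewrite /Rintegral (@continuous_FTC2 _ f F)//.
- exact: continuous_subspaceT.
- have cF : continuous F.
    by move=> x; apply: differentiable_continuous; apply/derivable1_diffP; case: (dF x).
  split.
  + by move=> x _; case: (dF x).
  + by apply: cvg_at_right_filter; exact: cF.
  + by apply: cvg_at_left_filter; exact: cF.
- by move=> x _; rewrite derive1E; exact: derive_val.
Qed.

Lemma Rintegral_sinX1 : J 1 = 1.
Proof.
have dF (x : R) : is_derive x (1 : R) (fun x => - cos x) (sin x ^+ 1).
  by apply: is_derive_eq; rewrite expr1 opprK.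
rewrite (Rintegral_FTC _ dF); last exact: cont_sinX.
by rewrite cos_pihalf cos0; ring.
Qed.

(** The difference of the two sides integrates the derivative of [cos x * sin x ^+ n.+1], which
    vanishes at 0 and at [pi / 2]. *)
Lemma Rintegral_sinXSS n : n.+2%:R * J n.+2 = n.+1%:R * J n.
Proof.
pose f x : R := n.+1%:R * sin x ^+ n - n.+2%:R * sin x ^+ n.+2.
have cf (k : nat) (c : R) : continuous (fun x => c * sin x ^+ k).
  by move=> x; refine (cvgM _ _); [exact: cvg_cst|exact: cont_sinX].
have fE : Rintegral mu `[0, pi / 2] f = n.+1%:R * J n - n.+2%:R * J n.+2.
  rewrite /f RintegralB//; [|exact: integrable_cont|exact: integrable_cont].
  by rewrite !RintegralZl//; exact/integrable_cont/cont_sinX.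
apply/esym/eqP; rewrite -subr_eq0 -fE; apply/eqP.
have dF (x : R) : is_derive x (1 : R) (fun x => cos x * sin x ^+ n.+1) (f x).
  rewrite (_ : (fun _ => _) = @cos R * (@sin R) ^+ n.+1); last first.
    by apply/funext => y; rewrite -[RHS]/(cos y * (sin ^+ n.+1) y) exprfctE.
  apply: is_derive_eq; rewrite /f /GRing.scale /= exprfctE.
  rewrite mulrCA [cos x * cos x](_ : _ = 1 - sin x ^+ 2); last first.
    by rewrite -(cos2Dsin2 x) expr2; ring.
  by rewrite -[n.+2%:R]natr1 !exprS; ring.
rewrite (Rintegral_FTC _ dF).
  by rewrite cos_pihalf sin0 expr0n /= mul0r mulr0 subrr.
by move=> x; refine (cvgB _ _); exact: cf.
Qed.

Lemma Rintegral_sinX_decr n : J n.+1 <= J n.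
Proof.
apply: le_Rintegral => //; [exact/integrable_cont/cont_sinX|
  exact/integrable_cont/cont_sinX|] => x /=; rewrite in_itv /= => /andP[x0 xpi].
rewrite exprS ler_piMl ?sin_le1//.
apply: exprn_ge0; apply: sin_ge0_pi; rewrite x0 /=.
apply: (le_trans xpi); have := pi_gt0 R; lra.
Qed.

Lemma Rintegral_sinX_even m : J m.*2 = central R m * (pi / 2).
Proof.
elim: m => [|m IH]; first by rewrite Rintegral_sinX0 mul1r.
have [_ d1 d2 _] := natr_double R m; have m0 : 0 <= m%:R :> R by [].
have n2 : (m.*2).+2%:R != 0 :> R by rewrite pnatr_eq0.
apply: (mulfI n2); rewrite doubleS Rintegral_sinXSS IH d1 d2 /=.
by field; rewrite gt_eqF//; lra.
Qed.

Lemma Rintegral_sinX_odd m : J (m.*2).+1 = ((2 * m%:R + 1) * central R m)^-1.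
Proof.
elim: m => [|m IH]; first by rewrite Rintegral_sinX1 /= mulr0 add0r mulr1 invr1.
have [_ d1 d2 d3] := natr_double R m; have m0 : 0 <= m%:R :> R by [].
have n2 : (m.*2).+3%:R != 0 :> R by rewrite pnatr_eq0.
apply: (mulfI n2); rewrite doubleS Rintegral_sinXSS IH d2 d3 /= -(natr1 m).
have c0 := central_gt0 R m.
by field; rewrite !gt_eqF//; lra.
Qed.

(* Wallis: J(2m + 1) <= J(2m) <= J(2m - 1). *)
Lemma central_wallis m : (0 < m)%N ->
  2 / pi * ((m.*2)%:R / (m.*2).+1%:R) <= central R m ^+ 2 * (m.*2)%:R <= 2 / pi.
Proof.
case: m => // m _.
have [d0 d1 d2 d3] := natr_double R m; have m0 : 0 <= m%:R :> R by [].
have p0 := pi_gt0 R; have c0 := central_gt0 R m.+1.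
have := Rintegral_sinX_decr m.+1.*2; rewrite Rintegral_sinX_even Rintegral_sinX_odd => h1.
have := Rintegral_sinX_decr (m.*2).+1.
rewrite -doubleS Rintegral_sinX_even Rintegral_sinX_odd => h2.
(* With [x = 2(m+1)] and [c = central R m.+1], the three consecutive integrals become [1/((x+1)c)],
   [c * pi / 2] and [1/(xc)]. *)
have cE : (2 * m%:R + 1) * central R m = (m.+1.*2)%:R * central R m.+1.
  by rewrite doubleS d2 /=; field; rewrite gt_eqF//; lra.
have xE : (m.+1.*2).+1%:R = (m.+1.*2)%:R + 1 :> R by rewrite natr1.
have xE' : 2 * m.+1%:R + 1 = (m.+1.*2)%:R + 1 :> R by rewrite -muln2 natrM mulrC.
rewrite cE in h2; rewrite xE' in h1; rewrite xE.
have x0 : 0 < (m.+1.*2)%:R :> R by rewrite ltr0n double_gt0.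
move: (m.+1.*2)%:R (central R m.+1) x0 c0 h1 h2 => x c x0 c0.
have xc : 0 < x * c by exact: mulr_gt0.
have x1c : 0 < (x + 1) * c by apply: mulr_gt0 => //; lra.
rewrite -[_^-1]mul1r ler_pdivrMr// => h1.
rewrite -[(x * c)^-1]mul1r ler_pdivlMr// => h2.
have p1 : 2 / pi * pi = 2 :> R by rewrite divfK// gt_eqF.
apply/andP; split.
- rewrite mulrA ler_pdivrMr; last by lra.
  by rewrite mulrAC ler_pdivrMr//; nra.
- by rewrite ler_pdivlMr//; nra.
Qed.

Let root4 (x : R) : 0 <= x -> (x `^ (1 / 4)) ^+ 4 = x.
Proof.
move=> x0; rewrite -powR_mulrn ?powR_ge0// -powRrM divfK ?pnatr_eq0//.
by rewrite powRr1.
Qed.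

Let pow4_le (x y : R) : 0 <= x -> 0 <= y -> x ^+ 4 <= y ^+ 4 -> x <= y.
Proof. by move=> x0 y0; rewrite ler_pXn2r. Qed.

Let kappa : R := 2 `^ (1 / 4) / pi `^ (1 / 4).

Let kappa4 : kappa ^+ 4 = 2 / pi.
Proof. by rewrite expr_div_n !root4// pi_ge0. Qed.

(** The modulus of the mean divided by [n^(-1/4) sqrt(n!)], which has to tend to [kappa]. Its fourth
    power contains no roots and is the quantity in Wallis' bounds. *)
Let rho n : R := n`!%:R / ((n./2)`!%:R * 2 ^+ n./2) * n%:R `^ (1 / 4) / Num.sqrt n`!%:R.

Let rho4 m : rho m.*2 ^+ 4 = central R m ^+ 2 * (m.*2)%:R.
Proof.
rewrite /rho doubleK central_fact expr_div_n exprMn root4//.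
have -> : Num.sqrt (m.*2)`!%:R ^+ 4 = (m.*2)`!%:R ^+ 2 :> R.
  by rewrite (exprM _ 2 2) sqr_sqrtr.
have -> : 4 = 2 ^+ 2 :> R by ring.
rewrite -exprM mulnC exprM.
have f0 k : k`!%:R != 0 :> R by rewrite pnatr_eq0 -lt0n fact_gt0.
have p2 : 2 ^+ m != 0 :> R by rewrite expf_neq0// pnatr_eq0.
by field; rewrite !f0 p2.
Qed.

Let rho_bounds m : (0 < m)%N ->
  kappa * ((m.*2)%:R / (m.*2).+1%:R) <= rho m.*2 <= kappa.
Proof.
move=> m0; have /andP[b1 b2] := central_wallis m0.
have k0 : 0 <= kappa by rewrite divr_ge0// powR_ge0.
have r0 : 0 <= rho m.*2.
  apply: divr_ge0; last exact: sqrtr_ge0.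
  apply: mulr_ge0; last exact: powR_ge0.
  by apply: divr_ge0 => //; apply: mulr_ge0 => //; exact: exprn_ge0.
have q0 : 0 <= (m.*2)%:R / (m.*2).+1%:R :> R by [].
have q1 : (m.*2)%:R / (m.*2).+1%:R <= 1 :> R.
  by rewrite ler_pdivrMr// mul1r ler_nat.
apply/andP; split; apply: pow4_le => //.
- by rewrite mulr_ge0.
- rewrite rho4 exprMn kappa4; apply: le_trans b1.
  rewrite ler_wpM2l ?divr_ge0 ?pi_ge0//.
  (* [q^4 <= q] for [q = n/(n+1)]: the lower bound keeps [q] itself where its fourth root would be
     sharp. *)
  by rewrite exprS ler_piMr// exprn_ile1.
- by rewrite rho4 kappa4.
Qed.

Lemma mean_det_asymptotics : exists eps : nat -> R,
  eps n @[n --> \oo] --> (0 : R) /\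
  forall n, (0 < n)%N -> ~~ odd n -> mean_det R n =
    ((-1) ^+ n./2 * 2 `^ (1 / 4) / pi `^ (1 / 4) + eps n)
      * n%:R `^ (- (1 / 4)) * Num.sqrt n`!%:R.
Proof.
(* The sign is put into the error term. Odd [n] and [n = 0] lie outside the claim, and the value 0
   there leaves the limit along all [n] intact. *)
exists (fun n => if odd n || (n == 0%N) then 0 else (-1) ^+ n./2 * (rho n - kappa)).
have k0 : 0 <= kappa by rewrite divr_ge0// powR_ge0.
split.
  have hk : (fun n => kappa * harmonic n) @ \oo --> (0 : R).
    by rewrite -(mulr0 kappa); apply: cvgMl_tmp; exact: cvg_harmonic.
  have hkN : (fun n => - (kappa * harmonic n)) @ \oo --> (0 : R).
    by rewrite -oppr0; exact: cvgN.
  apply: (squeeze_cvgr _ hkN hk); apply: nearW => n.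
  rewrite -ler_norml; case: ifPn => [_|].
    by rewrite normr0 mulr_ge0 ?invr_ge0.
  rewrite negb_or -lt0n => /andP[on n0].
  rewrite normrM normrX normrN1 expr1n mul1r.
  have nE : n = (n./2).*2 by rewrite even_halfK.
  have m0 : (0 < n./2)%N by rewrite -double_gt0 -nE.
  have := rho_bounds m0; rewrite -nE => /andP[b1 b2].
  (* The error is at most [kappa - kappa * n/(n+1) = kappa/(n+1)]. *)
  rewrite ler0_norm ?subr_le0// opprB lerBlDl; apply: le_trans (lerD b1 (lexx _)).
  rewrite /harmonic /= -mulrDr -[X in _ + X]mul1r -mulrDl natr1 divff ?mulr1//.
move=> n n0 on; rewrite (negbTE on) gtn_eqF//= /mean_det (negbTE on).
rewrite -[X in X + _]mulrA -mulrDr -/kappa [kappa + _]addrC subrK /rho powRN.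
have s0 : Num.sqrt n`!%:R != 0 :> R by rewrite sqrtr_eq0 -ltNge ltr0n fact_gt0.
have p0 : n%:R `^ (1 / 4) != 0 :> R by rewrite gt_eqF// powR_gt0// ltr0n.
move: (n`!%:R / _) (n%:R `^ _) (Num.sqrt _) p0 s0 => A p s p0 s0.
by field; rewrite p0 s0.
Qed.

End Wallis.

(** * Conjugates and moduli under the expectation *)

Section ConjugateExpectation.
Context {d : measure_display} {T : measurableType d} {R : realType}.
Variable P : probability T R.
Implicit Types Z W : T -> R[i].

Lemma cexpect_conj Z : cintegrable P Z ->
  cintegrable P (fun t => conjc (Z t)) /\
  cexpect P (fun t => conjc (Z t)) = conjc (cexpect P Z).
Proof.
move=> [ZR ZI].
have eR : (fun t => Re (conjc (Z t))) = (fun t => Re (Z t)).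
  by apply/funext => t; case: (Z t).
have eI : (fun t => Im (conjc (Z t))) = (fun t => -1 * Im (Z t)).
  by apply/funext => t; case: (Z t) => x y /=; rewrite mulN1r.
split.
  split; first by under eq_fun do rewrite (congr1 (@^~ _) eR).
  under eq_fun do rewrite (congr1 (@^~ _) eI) EFinM.
  exact: integrableZl.
by rewrite /cexpect eR eI RintegralZl//= mulN1r.
Qed.

Lemma cexpect_ae Z W : cmeasurable Z -> cmeasurable W ->
  {ae P, forall t, Z t = W t} -> cexpect P Z = cexpect P W.
Proof.
move=> [ZR ZI] [WR WI] ZW; rewrite /cexpect /Rintegral; congr Complex; congr fine.
- apply: ae_eq_integral => //; try exact/measurable_EFinP.
  by apply: filterS ZW => t -> _.
- apply: ae_eq_integral => //; try exact/measurable_EFinP.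
  by apply: filterS ZW => t -> _.
Qed.

Lemma mulc_conj (z : R[i]) : z * conjc z = real_complex R (Re z ^+ 2 + Im z ^+ 2).
Proof. by case: z => x y; rewrite /= -[LHS]/(Complex _ _) -!complexr0; congr Complex; ring. Qed.

Lemma normc_sqr (z : R[i]) : ComplexField.Normc.normc z ^+ 2 = Re z ^+ 2 + Im z ^+ 2.
Proof.
by case: z => x y /=; rewrite sqr_sqrtr// addr_ge0// sqr_ge0.
Qed.

Lemma abs_sq_cexpect Z v : cmeasurable Z -> abs_sq_expectation P Z = v%:E ->
  cintegrable P (fun t => Z t * conjc (Z t)) /\
  cexpect P (fun t => Z t * conjc (Z t)) = real_complex R v.
Proof.
move=> mZ ZE; apply: has_expectation_cintegrable.
  by apply: cmeasurableM => //; exact: cmeasurable_conj.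
split.
- rewrite -ZE /abs_sq_expectation; congr expectation; apply/funext => t.
  by rewrite mulc_conj normc_sqr.
- under eq_fun do rewrite mulc_conj /=.
  by rewrite expectation_cst.
Qed.

End ConjugateExpectation.

(** * Wigner matrices satisfy the assumptions on the first moment *)

Section WignerFacts.
Context {d : measure_display} {T : measurableType d} {R : realType}.
Variables (P : probability T R) (n : nat) (M : T -> 'M[R[i]]_n) (sigma2 : R).
Hypothesis wig : wigner_hermitian P sigma2 M.
Local Notation E := (cexpect P).

Lemma wigner_herm t : M t \is hermsymmx. Proof. by case: wig. Qed.

Lemma wigner_measurable i j :
  measurable_fun [set: T] (fun t => re_im (M t i j)).
Proof. by case: wig. Qed.

Lemma wigner_indep : mutually_independent P
  (fun k : 'I_n * 'I_n => (k.1 <= k.2)%N) (fun k t => re_im (M t k.1 k.2)).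
Proof. by case: wig. Qed.

Lemma wigner_conj i j t : M t i j = conjc (M t j i).
Proof. exact/hermsymmxE/wigner_herm. Qed.

Lemma wigner_cmeasurable i j : cmeasurable (fun t => M t i j).
Proof.
split.
- exact: (measurableT_comp measurable_fst (wigner_measurable i j)).
- exact: (measurableT_comp measurable_snd (wigner_measurable i j)).
Qed.

Lemma wigner_mean i j : cintegrable P (fun t => M t i j) /\ E (fun t => M t i j) = 0.
Proof.
have upper_mean (a b : 'I_n) : (a <= b)%N ->
    cintegrable P (fun t => M t a b) /\ E (fun t => M t a b) = 0.
  move=> ab; apply: has_expectation_cintegrable; first exact: wigner_cmeasurable.
  have [_ _ _ off diag] := wig; move: ab; rewrite leq_eqVlt => /orP[/eqP/ord_inj <-|ab].
    by case: (diag a).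
  by case: (off a b ab).
have [ij|ji] := leqP i j; first exact: upper_mean.
have [ci ce] := upper_mean _ _ (ltnW ji).
under eq_fun do rewrite wigner_conj; have [? ->] := cexpect_conj ci.
by rewrite ce conjc0.
Qed.

Lemma wigner_variance i j : cintegrable P (fun t => M t i j * M t j i) /\
  E (fun t => M t i j * M t j i) = real_complex R (if i == j then sigma2 else 1).
Proof.
have [_ _ _ off diag] := wig.
have off_var (a b : 'I_n) : (a < b)%N ->
    cintegrable P (fun t => M t a b * M t b a) /\ E (fun t => M t a b * M t b a) = 1.
  move=> ab; under eq_fun do rewrite [M _ b a]wigner_conj.
  apply: abs_sq_cexpect; first exact: wigner_cmeasurable.
  by case: (off a b ab).
have [ij|ji|/ord_inj ->] := ltngtP i j.
- by rewrite -val_eqE ltn_eqF//; exact: off_var.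
- by under eq_fun do rewrite mulrC; rewrite -val_eqE gtn_eqF//; exact: off_var.
- under eq_fun do rewrite [X in _ * X]wigner_conj; rewrite eqxx.
  apply: abs_sq_cexpect; first exact: wigner_cmeasurable.
  by case: (diag j).
Qed.

(** At most two distinct positions, [(i, j)] and [(j, i)], reflect to the same upper one. A group is
    therefore 1, an entry, or the square of its modulus, all integrable by the first two moments. *)
Lemma wigner_admissible L : uniq L -> admissible P M L.
Proof.
move=> uL k uk.
suff : cintegrable P (fun t => \prod_(l <- [seq l <- L | upper l == k])
    entry_of l (re_im (M t k.1 k.2))).
  by rewrite /upper_factor; under eq_fun do rewrite big_filter.
have : uniq [seq l <- L | upper l == k] by rewrite filter_uniq.
have : all (fun l => upper l == k) [seq l <- L | upper l == k] by rewrite filter_all.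
have entryE l t : upper l = k -> entry_of l (re_im (M t k.1 k.2)) = M t l.1 l.2.
  move=> <-; rewrite /entry_of /upper; case: (l.1 <= l.2)%N => /=.
    by case: (M t l.1 l.2).
  by rewrite [RHS]wigner_conj; case: (M t l.2 l.1).
case: [seq l <- L | upper l == k] => [|a [|b [|c s]]].
- by move=> _ _; under eq_fun do rewrite big_nil; exact: (cexpect_cst P 1).1.
- rewrite /= andbT => /eqP ak _; under eq_fun do rewrite big_seq1 (entryE _ _ ak).
  exact: (wigner_mean _ _).1.
- rewrite /= andbT => /andP[/eqP ak /eqP bk]; rewrite inE andbT => ab.
  under eq_fun do rewrite big_cons big_seq1 (entryE _ _ ak) (entryE _ _ bk).
  have := upper_eq a b; rewrite ak bk eqxx (negbTE ab) /= => /esym/eqP ->.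
  under eq_fun do rewrite mulrC /=; exact: (wigner_variance _ _).1.
- move=> /= /and4P[/eqP ak /eqP bk /eqP ck _].
  rewrite !inE !negb_or => /andP[/and3P[ab ac _] /andP[/andP[bc _] _]].
  have := upper_eq a c; rewrite ak ck eqxx (negbTE ac) /= => /esym/eqP ac'.
  have := upper_eq b c; rewrite bk ck eqxx (negbTE bc) /= => /esym/eqP bc'.
  by move: ab; rewrite ac' bc' eqxx.
Qed.

Lemma wigner_mean_mono i j : E (mono M [:: (i, j)]) = 0.
Proof. by rewrite mono1 (wigner_mean i j).2. Qed.

Lemma wigner_variance_mono i j : i != j -> E (mono M [:: (i, j); (j, i)]) = 1.
Proof. by move=> ij; rewrite mono2 (wigner_variance i j).2 (negbTE ij). Qed.

Lemma detE t : \det (M t) = minor (M t) id id.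
Proof. by congr determinant; apply/matrixP => i j; rewrite mxE. Qed.

Theorem wigner_expect_det :
  has_expectation P (fun t => \det (M t)) (mean_det _ n).
Proof.
have H := @expect_minor _ _ _ P n M wigner_herm wigner_measurable wigner_indep
  wigner_admissible wigner_mean_mono wigner_variance_mono n id (fun _ _ => id).
under eq_fun do rewrite detE; rewrite -H; apply: cintegrable_has_expectation.
exact: (@minor_cintegrable _ _ _ P n M wigner_herm wigner_measurable wigner_indep
  wigner_admissible n id id (fun _ _ => id)).
Qed.

End WignerFacts.

(** * Moments of a centered real Gaussian variable *)

Section GaussianLaw.
Context {d : measure_display} {T : measurableType d} {R : realType}.
Variables (P : probability T R) (X : T -> R) (v : R).
Hypotheses (mX : measurable_fun [set: T] X) (v0 : 0 < v).
Hypothesis XN : has_gaussian_law P X 0 v.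
Local Notation s := (Num.sqrt v).
Local Notation w := (normal_pdf 0 s).

Let s0 : s != 0. Proof. by rewrite sqrtr_eq0 -ltNge. Qed.

Let wE x : w x = normal_peak s * expR (- x ^+ 2 / (v *+ 2)).
Proof. by rewrite normal_pdfE// /normal_fun subr0 sqr_sqrtr// ltW. Qed.

Lemma ge0_expect_gaussian (f : R -> R) : measurable_fun [set: R] f ->
  (forall x, 0 <= f x) ->
  (\int[P]_t (f (X t))%:E = \int[lebesgue_measure]_x (f x * w x)%:E)%E.
Proof.
move=> mf f0.
transitivity (\int[P]_t ((f (X t))%:E * (cst 1%R t)%:E))%E.
  by apply: eq_integral => t _; rewrite mule1.
apply: (@ge0_integral_weighted_eq _ _ _ _ (measurableTypeR R) (measurableTypeR R) R
  P lebesgue_measure X id (cst 1) w (EFin \o f)) => //.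
- exact: measurable_normal_pdf.
- by move=> x; exact: normal_pdf_ge0.
- exact/measurable_EFinP.
move=> B mB; under eq_integral do rewrite mule1.
have mXB : measurable (X @^-1` B) by rewrite -[_ @^-1` _]setTI; exact: mX.
transitivity (P (X @^-1` B)).
  by rewrite -[X in P X]setIT -integral_indic.
rewrite -[LHS]/(pushforward P X B) XN// /normal_prob.
rewrite [LHS]integral_mkcond.
apply: eq_integral => x _.
by rewrite /= patchE indicE; case: ifP => _; rewrite ?mul1e ?mul0e.
Qed.

Let bnd (k : nat) : R := (v *+ 4) ^+ k.+1 * k.+1`!%:R.

(** For [|x| > 1] the power is at most [x^(2k+2)], a multiple of one term of the exponential series.
    The rate [1/(4v)] is half that of the density, so that their product still decays. *)
Let norm_pow_le (x : R) k : `|x| ^+ k <= 1 + bnd k * expR (x ^+ 2 / (v *+ 4)).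
Proof.
have b0 : 0 <= bnd k by rewrite mulr_ge0// exprn_ge0// mulrn_wge0// ltW.
have [x1|x1] := leP `|x| 1.
  by apply: ler_wpDr; [exact: mulr_ge0 b0 (expR_ge0 _)|exact: exprn_ile1].
have v4 : 0 < v *+ 4 by rewrite mulrn_wgt0.
apply: (@le_trans _ _ (bnd k * ((x ^+ 2 / (v *+ 4)) ^+ k.+1 / k.+1`!%:R))).
  have f0 : k.+1`!%:R != 0 :> R by rewrite pnatr_eq0 -lt0n fact_gt0.
  have p0 : (v *+ 4) ^+ k.+1 != 0 by rewrite expf_neq0// gt_eqF.
  have -> : bnd k * ((x ^+ 2 / (v *+ 4)) ^+ k.+1 / k.+1`!%:R) = (x ^+ 2) ^+ k.+1.
    have alg (p f q : R) : p != 0 -> f != 0 -> p * f * (q / p / f) = q.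
      by move=> ? ?; field; apply/andP.
    by rewrite /bnd expr_div_n alg.
  rewrite -real_normK ?num_real// -exprM ler_eXn2l//; lia.
apply: ler_wpDl => //; rewrite ler_wpM2l//.
apply: le_trans (expR_ge1Dxn _ _); first by rewrite ler_wpDl.
by rewrite divr_ge0 ?sqr_ge0// ltW.
Qed.

(** Against the density of variance [v] the exponential leaves a multiple of the density of variance
    [2v]. *)
Let integrable_exp : P.-integrable setT (fun t => (expR (X t ^+ 2 / (v *+ 4)))%:E).
Proof.
have mE : measurable_fun [set: R] (fun x : R => expR (x ^+ 2 / (v *+ 4))).
  apply: measurableT_comp => //; apply: measurable_funM => //.
apply/integrableP; split.
  by apply/measurable_EFinP; exact: (measurableT_comp mE).
under eq_integral do rewrite gee0_abs ?lee_fin ?expR_ge0//.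
rewrite (ge0_expect_gaussian mE); last by move=> x; exact: expR_ge0.
pose s' := Num.sqrt (v *+ 2).
have v2 : 0 < v *+ 2 by rewrite mulrn_wgt0.
have s'0 : s' != 0 by rewrite sqrtr_eq0 -ltNge.
have p0 := normal_peak_gt0 s'0.
have E x : expR (x ^+ 2 / (v *+ 4)) * w x =
    normal_peak s / normal_peak s' * normal_pdf 0 s' x.
  rewrite wE normal_pdfE// /normal_fun subr0 sqr_sqrtr ?ltW// mulrCA -expRD.
  rewrite -mulrA mulKf ?gt_eqF//; congr (_ * expR _).
  by field; rewrite gt_eqF.
under eq_integral do rewrite E EFinM.
rewrite ge0_integralZl//.
- by rewrite integral_normal_pdf// mule1 ltry.
- by apply/measurable_EFinP; exact: measurable_normal_pdf.
- by move=> x _; rewrite lee_fin normal_pdf_ge0.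
- by rewrite lee_fin divr_ge0// ?ltW// normal_peak_gt0.
Qed.

Lemma gaussian_moments k : P.-integrable setT (fun t => (`|X t| ^+ k)%:E).
Proof.
have b0 : 0 <= bnd k by rewrite mulr_ge0// exprn_ge0// mulrn_wge0// ltW.
have i1 : P.-integrable setT
    (fun t => (1%:E + (bnd k * expR (X t ^+ 2 / (v *+ 4)))%:E)%E).
  apply: integrableD => //; first exact: finite_measure_integrable_cst.
  by under eq_fun do rewrite EFinM; apply: integrableZl => //; exact: integrable_exp.
apply: le_integrable i1 => //.
  apply/measurable_EFinP; apply: measurable_funX.
  exact: measurableT_comp.
move=> t _; rewrite -EFinD !abse_EFin lee_fin.
rewrite ger0_norm ?exprn_ge0// ger0_norm; first exact: norm_pow_le.
by rewrite addr_ge0// mulr_ge0// expR_ge0.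
Qed.

Let w_derive (x : R) : is_derive x (1 : R) (w : R -> R) (- (x / v) * w x).
Proof.
have -> : w = fun x => normal_peak s * (expR \o (fun x => - (2 * v)^-1 * x ^+ 2)) x.
  apply/funext => y; rewrite wE /=; congr (_ * expR _).
  by field; rewrite gt_eqF.
have dq : is_derive x (1 : R) (fun x : R => - (2 * v)^-1 * x ^+ 2) (- (x / v)).
  by apply: is_derive_eq; rewrite /GRing.scale /= mulr1; field; rewrite gt_eqF.
by apply: is_derive_eq; rewrite /GRing.scale /=; ring.
Qed.

(** The boundary term of the integration by parts behind [E X^4 = 3v E X^2], found from
    [w' = -(x/v) w]. *)
Let F (x : R) := - v * x ^+ 3 * w x.

Let F_derive (x : R) :
  is_derive x (1 : R) F (x ^+ 4 * w x - 3 * v * (x ^+ 2 * w x)).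
Proof.
have dw := w_derive x.
have d3 : is_derive x (1 : R) (fun x : R => - v * x ^+ 3) (- v * (3 * x ^+ 2)).
  by apply: is_derive_eq; rewrite /GRing.scale /=; ring.
have -> : F = (fun x => - v * x ^+ 3) * w by [].
by apply: is_derive_eq; rewrite /GRing.scale /=; field; rewrite gt_eqF.
Qed.

Let xw_continuous k : continuous (fun x : R => x ^+ k * w x).
Proof.
move=> x; refine (cvgM _ _); first exact: exprn_continuous.
exact: continuous_normal_pdf.
Qed.

Let itv (n : nat) : set (measurableTypeR R) := `[- n.+1%:R, n.+1%:R].

Let xw_integrable k n :
  lebesgue_measure.-integrable (itv n) (EFin \o (fun x => x ^+ k * w x)).
Proof.
apply: continuous_compact_integrable; first exact: segment_compact.
exact: continuous_subspaceT.
Qed.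

Let parts_eq n : (\int[lebesgue_measure]_(x in itv n) (x ^+ 4 * w x)%:E =
  (F n.+1%:R - F (- n.+1%:R))%:E +
  (3 * v)%:E * \int[lebesgue_measure]_(x in itv n) (x ^+ 2 * w x)%:E)%E.
Proof.
have cf : continuous (fun x : R => x ^+ 4 * w x - 3 * v * (x ^+ 2 * w x)).
  move=> x; refine (cvgB _ _); first exact: xw_continuous.
  by refine (cvgM _ _); [exact: cvg_cst|exact: xw_continuous].
have ft : (\int[lebesgue_measure]_(x in itv n)
   (x ^+ 4 * w x - 3 * v * (x ^+ 2 * w x))%:E =
   (F n.+1%:R)%:E - (F (- n.+1%:R))%:E)%E.
  apply: continuous_FTC2.
  - by rewrite gtrN// ltr0n.
  - exact: continuous_subspaceT.
  - have cF : continuous F.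
      by move=> x; apply: differentiable_continuous; apply/derivable1_diffP; case: (F_derive x).
    split.
    + by move=> x _; case: (F_derive x).
    + by apply: cvg_at_right_filter; exact: cF.
    + by apply: cvg_at_left_filter; exact: cF.
  - by move=> x _; rewrite derive1E; exact: derive_val.
have mi : measurable (itv n) by exact: measurable_itv.
rewrite EFinB -ft -integralZl//=; last exact: xw_integrable.
rewrite -integralD//=.
- by apply: eq_integral => x _; rewrite -EFinM -EFinD subrK.
- apply: (@continuous_compact_integrable _
      (fun x : R => x ^+ 4 * w x - 3 * v * (x ^+ 2 * w x))).
    exact: segment_compact.
  exact: continuous_subspaceT.
- by apply: integrableZl => //; exact: xw_integrable.
Qed.

Let itv_cvg k : ~~ odd k ->
  (\int[lebesgue_measure]_(x in itv n) (x ^+ k * w x)%:E @[n --> \oo] -->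
   \int[P]_t (X t ^+ k)%:E)%E.
Proof.
move=> ek.
have xk0 (x : R) : 0 <= x ^+ k by rewrite exprn_even_ge0.
rewrite (ge0_expect_gaussian (f := fun x => x ^+ k))//.
have -> : [set: measurableTypeR R] = \bigcup_n itv n.
  apply/seteqP; split => // x _; exists (Num.truncn `|x|) => //=.
  rewrite /itv /= in_itv /= -ler_norml ltW//; exact: truncnS_gt.
apply: ge0_nondecreasing_set_cvg_integral.
- move=> m n mn; rewrite subsetEset /itv => x /=.
  rewrite !in_itv /= -!ler_norml => /le_trans; apply.
  by rewrite ler_nat.
- by move=> n; exact: measurable_itv.
- move=> n; apply/measurable_EFinP; apply: measurable_funTS.
  apply: measurable_funM; first exact: measurable_funX.
  exact: measurable_normal_pdf.
- by move=> n x _; rewrite lee_fin mulr_ge0// normal_pdf_ge0.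
Qed.

(** The exponential in [w] is [e * e]: one factor absorbs the growth allowed by [norm_pow_le], the
    other is at most 1. *)
Let tail_bound (x : R) : x ^+ 4 * w x <= normal_peak s * (1 + bnd 4).
Proof.
have b0 : 0 <= bnd 4 by rewrite mulr_ge0// exprn_ge0// mulrn_wge0// ltW.
have v4 : 0 < v *+ 4 by rewrite mulrn_wgt0.
pose e := expR (- (x ^+ 2 / (v *+ 4))).
have e0 : 0 <= e by exact: expR_ge0.
have e1 : e <= 1.
  by rewrite -expR0 ler_expR oppr_le0 divr_ge0 ?sqr_ge0// ltW.
have we : w x = normal_peak s * (e * e).
  by rewrite wE -expRD; congr (_ * expR _); field; rewrite gt_eqF.
rewrite we mulrCA ler_wpM2l ?normal_peak_ge0//.
have ee : expR (x ^+ 2 / (v *+ 4)) * e = 1 by rewrite -expRD subrr expR0.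
have := norm_pow_le x 4; rewrite -normrX ger0_norm ?exprn_even_ge0// => h.
apply: (@le_trans _ _ ((1 + bnd 4 * expR (x ^+ 2 / (v *+ 4))) * (e * e))).
  by rewrite ler_wpM2r// mulr_ge0.
rewrite mulrDl mul1r -mulrA [expR _ * (e * e)]mulrA ee mul1r lerD//.
  by rewrite mulr_ile1.
by rewrite ler_piMr.
Qed.

Let tail_cvg0 : F n.+1%:R - F (- n.+1%:R) @[n --> \oo] --> (0 : R).
Proof.
pose K := 2 * v * (normal_peak s * (1 + bnd 4)).
have hk : (fun n => K * harmonic n) @ \oo --> (0 : R).
  by rewrite -(mulr0 K); apply: cvgMl_tmp; exact: cvg_harmonic.
have hkN : (fun n => - (K * harmonic n)) @ \oo --> (0 : R).
  by rewrite -oppr0; exact: cvgN.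
apply: (squeeze_cvgr _ hkN hk); apply: nearW => n.
have N0 : 0 < n.+1%:R :> R by [].
have wN (x : R) : w (- x) = w x by rewrite !wE sqrrN.
(* [N^3 w(N)] is written as [N^4 w(N) / N]; the numerator is bounded uniformly and [1/N] gives the
   decay. *)
have -> : F n.+1%:R - F (- n.+1%:R) =
    - (2 * v * (n.+1%:R ^+ 4 * w n.+1%:R) * harmonic n).
  by rewrite /F wN /harmonic /=; field; rewrite gt_eqF.
have h0 : 0 <= harmonic n :> R by rewrite invr_ge0.
have w0 : 0 <= w n.+1%:R by exact: normal_pdf_ge0.
have p0 : 0 <= n.+1%:R ^+ 4 * w n.+1%:R by rewrite mulr_ge0// exprn_ge0.
rewrite lerN2 /K ler_wpM2r//=; last first.
  by rewrite ler_wpM2l ?tail_bound// mulr_ge0// ltW.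
apply: (@le_trans _ _ 0).
  by rewrite oppr_le0 !mulr_ge0// ltW.
have b0 : 0 <= bnd 4 by rewrite mulr_ge0// exprn_ge0// mulrn_wge0// ltW.
by rewrite !mulr_ge0 ?normal_peak_ge0 ?addr_ge0// ltW.
Qed.

Lemma gaussian_sqr_integrable : P.-integrable setT (fun t => (X t ^+ 2)%:E).
Proof.
have := gaussian_moments 2.
by under eq_fun do rewrite real_normK ?num_real//.
Qed.

(** Only the ratio of the two moments is computed from the density; the second moment itself is
    supplied by the variance of the Wigner entries. *)
Lemma gaussian_moment4 :
  (\int[P]_t (X t ^+ 4)%:E = (3 * v)%:E * \int[P]_t (X t ^+ 2)%:E)%E.
Proof.
have fB := integrable_fin_num measurableT gaussian_sqr_integrable.
have h4 := itv_cvg (k := 4) isT; have h2 := itv_cvg (k := 2) isT.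
apply: (cvg_unique _ h4) => //.
rewrite -[((3 * v)%:E * _)%E]add0e.
rewrite (_ : (fun n => _) = (fun n => (F n.+1%:R - F (- n.+1%:R))%:E +
    (3 * v)%:E * \int[lebesgue_measure]_(x in itv n) (x ^+ 2 * w x)%:E)%E); last first.
  by apply/funext => n; exact: parts_eq.
apply: cvgeD.
- by apply: fin_num_adde_defl; rewrite fin_numM.
- by apply: cvg_EFin; [exact: nearW|exact: tail_cvg0].
- exact: cvgeZl.
Qed.

End GaussianLaw.

(** * Variables with all moments *)

Section Moments.
Context {d : measure_display} {T : measurableType d} {R : realType}.
Variable P : probability T R.

Definition has_moments (X : T -> R) := measurable_fun setT X /\
  forall k, P.-integrable setT (fun t => (`|X t| ^+ k)%:E).

(** Meant for the imaginary parts of real Gaussian entries, which vanish only almost surely. *)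
Lemma ae_zero_has_moments (X : T -> R) : measurable_fun setT X ->
  {ae P, forall t, X t = 0} -> has_moments X.
Proof.
move=> mX X0; split => // k.
have mk : measurable_fun [set: T] (fun t => (`|X t| ^+ k)%:E).
  apply/measurable_EFinP; apply: measurable_funX; exact: measurableT_comp.
apply/integrableP; split => //.
rewrite (@ae_eq_integral _ _ _ P setT (cst (0 ^+ k)%:E))//.
- by rewrite integral_cst// [X in (_ * X)%E](_ : _ = 1%E) ?mule1 ?ltry//; exact: probability_setT.
- by apply: measurableT_comp => //; exact: abse_measurable.
- apply: filterS X0 => t Xt _ /=; rewrite Xt normr0 ger0_norm//.
Qed.

Lemma cintegrable_normc_le (Z : T -> R[i]) (g : T -> R) : cmeasurable Z ->
  P.-integrable setT (EFin \o g) ->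
  (forall t, ComplexField.Normc.normc (Z t) <= g t) -> cintegrable P Z.
Proof.
move=> [mR mI] ig Zg.
have lem (x y : R) : 0 <= y -> `|x| <= Num.sqrt (x ^+ 2 + y).
  by move=> y0; rewrite -sqrtr_sqr ler_wsqrtr// lerDl.
split; apply: le_integrable ig => //; try exact/measurable_EFinP.
- move=> t _; rewrite /= lee_fin; apply: le_trans (ler_norm _); apply: le_trans (Zg t).
  by case: (Z t) => x y /=; exact/lem/sqr_ge0.
- move=> t _; rewrite /= lee_fin; apply: le_trans (ler_norm _); apply: le_trans (Zg t).
  by case: (Z t) => x y /=; rewrite addrC; exact/lem/sqr_ge0.
Qed.

Lemma normc_le_add (z : R[i]) :
  ComplexField.Normc.normc z <= `|Re z| + `|Im z|.
Proof.
case: z => x y /=; rewrite -(ger0_norm (addr_ge0 (normr_ge0 x) (normr_ge0 y))).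
rewrite -sqrtr_sqr ler_wsqrtr// sqrrD !real_normK ?num_real//.
by rewrite lerD2r lerDl mulrn_wge0// mulr_ge0.
Qed.

Lemma addX_le (a b : R) k : 0 <= a -> 0 <= b ->
  (a + b) ^+ k <= 2 ^+ k * (a ^+ k + b ^+ k).
Proof.
move=> a0 b0; wlog ab : a b a0 b0 / a <= b.
  move=> H; have [/H|/ltW/H] := leP a b; first exact.
  by rewrite addrC [b ^+ k + _]addrC; exact.
apply: (@le_trans _ _ ((2 * b) ^+ k)).
  by rewrite lerXn2r ?nnegrE ?addr_ge0 ?mulr_ge0//; lra.
by rewrite exprMn ler_wpM2l ?exprn_ge0// lerDr exprn_ge0.
Qed.

Lemma upper_factor_cintegrable n (L : seq ('I_n * 'I_n)) k (Z : T -> R[i]) :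
  has_moments (fun t => Re (Z t)) -> has_moments (fun t => Im (Z t)) ->
  cintegrable P (fun t => upper_factor L k (re_im (Z t))).
Proof.
move=> [mR iR] [mI iI].
have mf : cmeasurable (fun t => upper_factor L k (re_im (Z t))).
  rewrite /upper_factor; under eq_fun do rewrite -big_filter.
  apply: cmeasurable_prod => l; rewrite /entry_of /=.
  by case: (l.1 <= l.2)%N => //; exact: (cmeasurable_conj (Z := fun t => Complex _ _)).
(* Each of the [m] factors in the group is the entry or its conjugate, so that the group has modulus
   [|Z|^m]. *)
pose m := size [seq l <- L | upper l == k].
pose g t := 2 ^+ m * (`|Re (Z t)| ^+ m + `|Im (Z t)| ^+ m).
have ig : P.-integrable setT (EFin \o g).
  have i1 : P.-integrable setT (fun t => (2 ^+ m)%:E *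
      ((`|Re (Z t)| ^+ m)%:E + (`|Im (Z t)| ^+ m)%:E))%E.
    by apply: integrableZl => //; apply: integrableD => //.
  by apply: eq_integrable i1 => // t _ /=; rewrite EFinM EFinD.
apply: (cintegrable_normc_le mf ig) => t.
apply: (@le_trans _ _ (ComplexField.Normc.normc (Z t) ^+ m)); last first.
  apply: le_trans (addX_le m (normr_ge0 _) (normr_ge0 _)).
  have n0 : 0 <= ComplexField.Normc.normc (Z t) by case: (Z t) => x y; exact: sqrtr_ge0.
  by rewrite lerXn2r ?nnegrE ?addr_ge0// normc_le_add.
rewrite /upper_factor -big_filter /m.
elim: [seq l <- L | upper l == k] => [|l s IH].
  by rewrite big_nil ComplexField.Normc.normc1.
rewrite big_cons ComplexField.Normc.normcM exprS.
have eN : ComplexField.Normc.normc (entry_of l (re_im (Z t))) =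
    ComplexField.Normc.normc (Z t).
  by rewrite /entry_of; case: ifP => _; case: (Z t) => x y //=; rewrite sqrrN.
rewrite eN ler_wpM2l//; case: (Z t) => x y; exact: sqrtr_ge0.
Qed.

End Moments.

Lemma rmorph_sqr_det (C D : pzRingType) (f : {rmorphism C -> D}) b m :
  f (sqr_det b m) = sqr_det (f b) m.
Proof.
suff: f (sqr_det b m) = sqr_det (f b) m /\ f (sqr_det b m.+1) = sqr_det (f b) m.+1.
  by case.
elim: m => [|m [IH1 IH2]]; first by rewrite /= rmorph1.
split=> //; rewrite -[sqr_det b m.+2]/(b * sqr_det b m.+1 +
  m.+1%:R * (m.+1%:R + b) * sqr_det b m).
by rewrite rmorphD !rmorphM rmorphD !rmorph_nat IH1 IH2.
Qed.

(** * Second moment of the determinant for both ensembles *)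

Section WignerSecondMoment.
Context {d : measure_display} {T : measurableType d} {R : realType}.
Variables (P : probability T R) (n : nat) (M : T -> 'M[R[i]]_n) (beta : R).
Hypothesis wig : wigner_hermitian P beta M.
Local Notation E := (cexpect P).
Hypothesis moments : forall i j : 'I_n, (i <= j)%N ->
  has_moments P (fun t => Re (M t i j)) /\ has_moments P (fun t => Im (M t i j)).
Hypothesis beta12 : (beta - 1) * (beta - 1) = beta - 1.
Hypothesis sqr_upper : forall i j : 'I_n, (i < j)%N ->
  E (fun t => M t i j * M t i j) = real_complex R (beta - 1).
Hypothesis norm4_upper : forall i j : 'I_n, (i < j)%N ->
  E (fun t => (M t i j * conjc (M t i j)) * (M t i j * conjc (M t i j))) =
  real_complex R (beta + 1).
Hypothesis ae_symmetric :
  beta = 1 \/ {ae P, forall t, forall i j, M t i j = M t j i}.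

Lemma moments_admissible L : admissible P M L.
Proof. by move=> k /moments[mR mI]; exact: upper_factor_cintegrable. Qed.

Let adm := moments_admissible.
Let herm := wigner_herm wig.
Let mM := wigner_measurable wig.
Let indM := wigner_indep wig.

Let cint L : cintegrable P (mono M L).
Proof. exact: (expect_mono herm mM indM (adm L)).1. Qed.

Let bC := real_complex R beta.

Let diag2 i : E (mono M [:: (i, i); (i, i)]) = bC.
Proof. by rewrite mono2 (wigner_variance wig i i).2 eqxx. Qed.

Let off_sqr i j : i != j -> E (mono M [:: (i, j); (i, j)]) = bC - 1.
Proof.
have sub1 : bC - 1 = real_complex R (beta - 1) by rewrite rmorphB.
rewrite sub1 -val_eqE neq_ltn => /orP[ij|ji].
  by rewrite mono2 sqr_upper.
have ci := cint [:: (j, i); (j, i)].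
rewrite mono2 (_ : (fun t => _) = (fun t => conjc (mono M [:: (j, i); (j, i)] t))).
  by rewrite (cexpect_conj ci).2 mono2 sqr_upper// conjc_real.
by apply/funext => t; rewrite mono2 rmorphM /= -!(wigner_conj wig).
Qed.

Let off_norm4 i j : i != j ->
  E (mono M [:: (i, j); (j, i); (i, j); (j, i)]) = bC + 1.
Proof.
have add1 : bC + 1 = real_complex R (beta + 1) by rewrite rmorphD.
have swap a b t : conjc (M t a b) = M t b a by rewrite -(wigner_conj wig).
rewrite add1 -val_eqE neq_ltn => /orP[ij|ji].
- rewrite -(norm4_upper ij); congr E; apply/funext => t.
  by rewrite /mono !big_cons big_nil /= swap; ring.
- rewrite -(norm4_upper ji); congr E; apply/funext => t.
  by rewrite /mono !big_cons big_nil /= swap; ring.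
Qed.

Let bC12 : (bC - 1) * (bC - 1) = bC - 1.
Proof. by rewrite -[1](rmorph1 (real_complex R)) -rmorphB -rmorphM beta12. Qed.

Let polyM (W : pred 'I_n) G H : polynomial_in P M W G -> polynomial_in P M W H ->
  polynomial_in P M W (fun t => G t * H t).
Proof. exact: polynomialM. Qed.

(** The matrix is symmetric only almost surely, so the two cofactor products are compared through
    their expectations. *)
Let cominor_sym m (f : 'I_m -> 'I_n) k l : injective f ->
  (bC - 1) * E (fun t => cominor (M t) f f k l * cominor (M t) f f k l) =
  (bC - 1) * E (fun t => cominor (M t) f f k l * cominor (M t) f f l k).
Proof.
move=> fI; case: ae_symmetric => [b1|sym].
  have -> : bC - 1 = 0 by rewrite /bC b1 rmorph1 subrr.
  exact: etrans (mul0r _) (esym (mul0r _)).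
apply: (congr1 (fun x => (bC - 1) * x)).
have pc k' l' : polynomial_in P M xpredT (fun t => cominor (M t) f f k' l').
  by apply: cominor_polynomial => // L _; exact: adm.
have mc G : polynomial_in P M xpredT G -> cmeasurable G.
  by move=> pG; apply: cintegrable_measurable; exact: (polynomial_cintegrable herm mM indM pG).
apply: cexpect_ae; [exact/mc/polyM|exact/mc/polyM|].
apply: filterS sym => t symt.
apply: (congr1 (fun x => cominor (M t) f f k l * x)).
rewrite /cominor -cofactor_tr; congr (cofactor _ _ _).
by apply/matrixP => i j; rewrite !mxE symt.
Qed.

Lemma wigner_expect_det_sqr :
  abs_sq_expectation P (fun t => \det (M t)) = (sqr_det beta n)%:E.
Proof.
have H := @expect_minor_sqr _ _ _ P n M herm mM indM adm bC (wigner_mean_mono wig)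
  diag2 (wigner_variance_mono wig) off_sqr off_norm4 bC12 cominor_sym n id (fun _ _ => id).
have pd : polynomial_in P M xpredT (fun t => minor (M t) id id).
  by apply: minor_polynomial => // L _; exact: adm.
have ci := polynomial_cintegrable herm mM indM (polyM pd pd).
have [hR _] := cintegrable_has_expectation ci.
rewrite H -rmorph_sqr_det /= in hR; rewrite -hR /abs_sq_expectation.
congr expectation; apply/funext => t; rewrite normc_sqr -detE ReM.
(* A Hermitian determinant is real; hence the squared modulus is the plain square, for which the
   recursion was derived. *)
have -> : Im (\det (M t)) = 0.
  have : conjc (\det (M t)) = \det (M t).
    rewrite -[RHS]det_tr -[LHS](det_map_mx (@conjc R)); congr determinant.
    by apply/matrixP => i j; rewrite !mxE [RHS](wigner_conj wig).
  by case: (\det (M t)) => x y [] /= h; lra.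
by rewrite mulr0 subr0 expr0n addr0 expr2.
Qed.

End WignerSecondMoment.

(** * The entry moments of GOE and GUE *)

Section GaussianEnsembles.
Context {d : measure_display} {T : measurableType d} {R : realType}.
Variables (P : probability T R) (n : nat) (M : T -> 'M[R[i]]_n).
Local Notation E := (cexpect P).

Lemma cintegrable_real (f : T -> R) : P.-integrable setT (EFin \o f) ->
  cintegrable P (fun t => real_complex R (f t)).
Proof. by move=> fi; split => //; exact: finite_measure_integrable_cst. Qed.

Lemma gaussian_has_moments (X : T -> R) v : measurable_fun setT X -> 0 < v ->
  has_gaussian_law P X 0 v -> has_moments P X.
Proof. by move=> mX v0 XN; split => // k; exact: gaussian_moments XN k. Qed.

Lemma has_moments_even (X : T -> R) k : has_moments P X ->
  P.-integrable setT (EFin \o (fun t => X t ^+ (k + k))).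
Proof.
move=> [_ /(_ (k + k)%N)]; congr (integrable _ _ _); apply/funext => t /=.
by rewrite -normrX ger0_norm// exprD -expr2 sqr_ge0.
Qed.

Lemma gaussian_Rintegral4 (X : T -> R) v : measurable_fun setT X -> 0 < v ->
  has_gaussian_law P X 0 v ->
  Rintegral P setT (fun t => X t ^+ 4) =
  3 * v * Rintegral P setT (fun t => X t ^+ 2).
Proof.
move=> mX v0 XN; rewrite /Rintegral (gaussian_moment4 mX v0 XN) fineM//.
by apply: integrable_fin_num => //; exact: gaussian_sqr_integrable XN.
Qed.

Lemma GOE_expect_det_sqr : GOE P M ->
  abs_sq_expectation P (fun t => \det (M t)) = (sqr_det 2 n)%:E.
Proof.
move=> [wig off diag].
have gau (i j : 'I_n) : (i <= j)%N -> exists2 v : R, 0 < v &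
    has_real_gaussian_law P (fun t => M t i j) 0 v.
  rewrite leq_eqVlt => /orP[/eqP/ord_inj <-|/off ij]; first by exists 2.
  by exists 1.
have mij i j := wigner_cmeasurable wig i j.
have mom (i j : 'I_n) : (i <= j)%N ->
    has_moments P (fun t => Re (M t i j)) /\ has_moments P (fun t => Im (M t i j)).
  move=> /gau[v v0 [I0 RN]]; have [mR mI] := mij i j; split.
    exact: gaussian_has_moments RN.
  exact: ae_zero_has_moments.
have var (i j : 'I_n) : (i < j)%N -> E (fun t => M t i j * conjc (M t i j)) = 1.
  move=> ij; have := (wigner_variance wig i j).2; rewrite -val_eqE ltn_eqF//= rmorph1 => <-.
  by congr E; apply/funext => t; rewrite [M t j i](wigner_conj wig).
apply: (wigner_expect_det_sqr wig mom).
- ring.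
- move=> i j ij; have [I0 _] := off i j ij.
  rewrite (_ : 2 - 1 = 1) ?rmorph1; last by ring.
  rewrite -(var i j ij); apply: cexpect_ae.
  + exact: cmeasurableM.
  + by apply: cmeasurableM => //; exact: cmeasurable_conj.
  + by apply: filterS I0 => t; case: (M t i j) => x y /= ->; rewrite oppr0.
- move=> i j ij; have [I0 RN] := off i j ij.
  have [mR mI] := mij i j.
  have mm : cmeasurable (fun t => M t i j * conjc (M t i j)).
    by apply: cmeasurableM => //; exact: cmeasurable_conj.
  have [hR _] := mom i j (ltnW ij).
  have v1 : Rintegral P setT (fun t => Re (M t i j) ^+ 2) = 1.
    apply: complexI; rewrite -cexpect_real rmorph1 -(var i j ij).
    apply: cexpect_ae => //.
      by apply: cintegrable_measurable; apply: cintegrable_real; exact: (has_moments_even 1).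
    by apply: filterS I0 => t I0t; rewrite mulc_conj I0t expr0n addr0.
  transitivity (E (fun t => real_complex R (Re (M t i j) ^+ 4))).
    apply: cexpect_ae; first exact: cmeasurableM.
      by apply: cintegrable_measurable; apply: cintegrable_real; exact: (has_moments_even 2).
    apply: filterS I0 => t I0t; rewrite mulc_conj I0t expr0n addr0 -rmorphM -exprD.
    by [].
  rewrite cexpect_real (gaussian_Rintegral4 _ _ RN)// v1; congr (real_complex R _); ring.
- right.
  (* Finitely many positions, hence a single null set outside which the whole matrix is real, and so
     symmetric. *)
  have : {ae P, forall t, forall i j : 'I_n, (i <= j)%N -> Im (M t i j) = 0}.
    apply: filter_forall => i; apply: filter_forall => j.
    have [ij|ij] := leqP i j; last exact: nearW.
    by have [v _ [I0 _]] := gau i j ij; apply: filterS I0 => t It _.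
  apply: filterS => t It i j.
  have real (a b : 'I_n) : (a <= b)%N -> M t a b = M t b a.
    move=> ab; rewrite [RHS](wigner_conj wig); have := It a b ab.
    by case: (M t a b) => x y /= ->; rewrite oppr0.
  by have [/real//|/ltnW/real] := leqP i j.
Qed.

Lemma has_moments_odd (X : T -> R) k : has_moments P X ->
  P.-integrable setT (EFin \o (fun t => X t ^+ k)).
Proof.
move=> [mX /(_ k)]; apply: le_integrable => //.
  by apply/measurable_EFinP; exact: measurable_funX.
by move=> t _; rewrite /= lee_fin normrX [X in _ <= X]ger0_norm// exprn_ge0.
Qed.

(** The mixed term of [E Z^2] is the case [k = 1], that of [E |Z|^4] the case [k = 2]. *)
Lemma indep_parts_expect (Z : T -> R[i]) k :
  has_moments P (fun t => Re (Z t)) -> has_moments P (fun t => Im (Z t)) ->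
  mutually_independent P predT
    (fun (b : bool) t => if b then Re (Z t) else Im (Z t)) ->
  cintegrable P (fun t => real_complex R (Re (Z t) ^+ k * Im (Z t) ^+ k)) /\
  E (fun t => real_complex R (Re (Z t) ^+ k * Im (Z t) ^+ k)) =
  real_complex R (Rintegral P setT (fun t => Re (Z t) ^+ k) *
                  Rintegral P setT (fun t => Im (Z t) ^+ k)).
Proof.
move=> hR hI ind.
have mX (b : bool) : predT b -> measurable_fun [set: T]
    (fun t => if b then Re (Z t) else Im (Z t)) by case: b => _; [case: hR|case: hI].
have := @indep_prod _ _ T R R P bool predT
  (fun b t => if b then Re (Z t) else Im (Z t)) mX ind [:: true; false]
  (fun _ (y : R) => real_complex R (y ^+ k)).
rewrite !big_cons big_nil mulr1 /= (cexpect_real P (fun t => Re (Z t) ^+ k)).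
rewrite (cexpect_real P (fun t => Im (Z t) ^+ k)) -rmorphM.
under [X in cintegrable _ X]eq_fun do rewrite !big_cons big_nil mulr1 /= -rmorphM.
under [X in E X]eq_fun do rewrite !big_cons big_nil mulr1 /= -rmorphM.
apply => //.
- move=> b _; split => //=; exact: measurable_funX.
- move=> [] _; apply: cintegrable_real; exact: has_moments_odd.
Qed.

Lemma GUE_expect_det_sqr : GUE P M ->
  abs_sq_expectation P (fun t => \det (M t)) = (sqr_det 1 n)%:E.
Proof.
move=> [wig off diag].
have mij i j := wigner_cmeasurable wig i j.
have half0 : 0 < 2^-1 :> R by rewrite invr_gt0.
have mom (i j : 'I_n) : (i <= j)%N ->
    has_moments P (fun t => Re (M t i j)) /\ has_moments P (fun t => Im (M t i j)).
  have [mR mI] := mij i j.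
  rewrite leq_eqVlt => /orP[/eqP/ord_inj ij|/off[RN IN _]]; last first.
    by split; [exact: gaussian_has_moments RN|exact: gaussian_has_moments IN].
  rewrite -{}ij in mR mI *; have [I0 RN] := diag i; split.
    exact: gaussian_has_moments RN.
  exact: ae_zero_has_moments.
have sqr_eq (i j : 'I_n) : (i < j)%N -> 
    Rintegral P setT (fun t => Re (M t i j) ^+ 2) = 2^-1 /\
    Rintegral P setT (fun t => Im (M t i j) ^+ 2) = 2^-1.
  move=> ij; have [RN IN _] := off i j ij; have [mR mI] := mij i j.
  have [hR hI] := mom i j (ltnW ij).
  have iR := has_moments_even 1 hR; have iI := has_moments_even 1 hI.
  (* Real and imaginary part have the same law, hence equal second moments; these add up to the
     variance 1. *)
  have eq2 : Rintegral P setT (fun t => Re (M t i j) ^+ 2) =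
      Rintegral P setT (fun t => Im (M t i j) ^+ 2).
    have m2 : measurable_fun [set: R] (fun x : R => x ^+ 2) by exact: measurable_funX.
    rewrite /Rintegral (ge0_expect_gaussian mR RN m2); last exact: sqr_ge0.
    by rewrite (ge0_expect_gaussian mI IN m2); last exact: sqr_ge0.
  have := (wigner_variance wig i j).2; rewrite -val_eqE ltn_eqF//=.
  have -> : (fun t => M t i j * M t j i) =
      fun t => real_complex R (Re (M t i j) ^+ 2 + Im (M t i j) ^+ 2).
    by apply/funext => t; rewrite [M t j i](wigner_conj wig) mulc_conj.
  rewrite cexpect_real RintegralD// eq2 => /complexI sum1.
  by split; lra.
apply: (wigner_expect_det_sqr wig mom); last by left.
- ring.
- move=> i j ij; have [RN IN ind] := off i j ij.
  have [hR hI] := mom i j (ltnW ij); have [eR eI] := sqr_eq i j ij.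
  have [c1 e1] := indep_parts_expect 1 hR hI ind.
  have R0 : Rintegral P setT (fun t => Re (M t i j) ^+ 1) = 0.
    have := (wigner_mean wig i j).2 => /(congr1 (@complex.Re R)) /= <-.
    by congr Rintegral.
  rewrite R0 mul0r in e1.
  have iR := cintegrable_real (has_moments_even 1 hR).
  have iI := cintegrable_real (has_moments_even 1 hI).
  have [c2 e2] := cexpectB iR iI; have [c3 e3] := cexpectZ (Complex 0 2) c1.
  have [_ e4] := cexpectD c2 c3.
  (* [Z^2 = Re^2 - Im^2 + 2i Re Im]: the squares cancel in the mean, and the mixed term factors into
     means that vanish. *)
  rewrite (_ : (fun t => _) = (fun t => real_complex R (Re (M t i j) ^+ (1 + 1)) -
      real_complex R (Im (M t i j) ^+ (1 + 1)) +
      Complex 0 2 * real_complex R (Re (M t i j) ^+ 1 * Im (M t i j) ^+ 1))).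
    by rewrite e4 e3 e2 e1 !cexpect_real eR eI !subrr rmorph0 mulr0 addr0.
  apply/funext => t; case: (M t i j) => x y /=.
  by rewrite -[LHS]/(Complex _ _) !expr1 -!complexr0; simpc; congr Complex; ring.
- move=> i j ij; have [RN IN ind] := off i j ij; have [mR mI] := mij i j.
  have [hR hI] := mom i j (ltnW ij); have [eR eI] := sqr_eq i j ij.
  have [c1 e1] := indep_parts_expect 2 hR hI ind.
  have iR := cintegrable_real (has_moments_even 2 hR).
  have iI := cintegrable_real (has_moments_even 2 hI).
  have [c3 e3] := cexpectZ (real_complex R 2) c1.
  have [c2 e2] := cexpectD iR c3; have [_ e4] := cexpectD c2 iI.
  (* [|Z|^4 = Re^4 + 2 Re^2 Im^2 + Im^4] has mean [3/4 + 1/2 + 3/4 = 2], which is [beta + 1]. *)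
  rewrite (_ : (fun t => _) = (fun t => real_complex R (Re (M t i j) ^+ (2 + 2)) +
      real_complex R 2 * real_complex R (Re (M t i j) ^+ 2 * Im (M t i j) ^+ 2) +
      real_complex R (Im (M t i j) ^+ (2 + 2)))).
    rewrite e4 e2 e3 e1 !cexpect_real (gaussian_Rintegral4 mR half0 RN).
    rewrite (gaussian_Rintegral4 mI half0 IN) eR eI.
    rewrite -rmorphM -!rmorphD.
    by congr (real_complex R _); field.
  apply/funext => t; rewrite !mulc_conj.
  rewrite -!rmorphM -!rmorphD.
  by congr (real_complex R _); ring.
Qed.

End GaussianEnsembles.

(** * Assembly of the two moments *)

Lemma rmorph_mean_det (R : realType) m :
  mean_det R[i] m = real_complex R (mean_det R m).
Proof.
rewrite /mean_det; case: ifP => _; first by rewrite rmorph0.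
by rewrite rmorphM rmorphXn rmorphN1 fmorph_div rmorphM rmorphXn !rmorph_nat.
Qed.

Theorem theorem3 (R : realType) :
  (forall sigma2 : R, 0 < sigma2 ->
    [/\ forall (n : nat) (d : measure_display) (T : measurableType d)
          (P : probability T R) (M : T -> 'M[R[i]]_n),
          wigner_hermitian P sigma2 M -> odd n ->
          has_expectation P (fun t => \det (M t)) 0,
        forall (n : nat) (d : measure_display) (T : measurableType d)
          (P : probability T R) (M : T -> 'M[R[i]]_n),
          wigner_hermitian P sigma2 M -> ~~ odd n ->
          has_expectation P (fun t => \det (M t))
            ((-1) ^+ n./2 * (n`!%:R / ((n./2)`!%:R * 2 ^+ n./2))) &
        exists eps : nat -> R,
          eps n @[n --> \oo] --> (0 : R) /\
          forall (n : nat) (d : measure_display) (T : measurableType d)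
            (P : probability T R) (M : T -> 'M[R[i]]_n),
            wigner_hermitian P sigma2 M -> (0 < n)%N -> ~~ odd n ->
            has_expectation P (fun t => \det (M t))
              (real_complex R
                (((-1) ^+ n./2 * 2 `^ (1 / 4) / pi `^ (1 / 4) + eps n)
                 * n%:R `^ (- (1 / 4)) * Num.sqrt n`!%:R))])
  /\
  (exists c C : R, [/\ 0 < c, 0 < C &
    forall (n : nat) (d : measure_display) (T : measurableType d)
      (P : probability T R) (M : T -> 'M[R[i]]_n),
      (0 < n)%N -> GOE P M ->
      ((c * (n%:R `^ (3 / 2) * n`!%:R))%:E
         <= abs_sq_expectation P (fun t => \det (M t)))%E /\
      (abs_sq_expectation P (fun t => \det (M t))
         <= (C * (n%:R `^ (3 / 2) * n`!%:R))%:E)%E])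
  /\
  (exists c C : R, [/\ 0 < c, 0 < C &
    forall (n : nat) (d : measure_display) (T : measurableType d)
      (P : probability T R) (M : T -> 'M[R[i]]_n),
      (0 < n)%N -> GUE P M ->
      ((c * (n%:R `^ (1 / 2) * n`!%:R))%:E
         <= abs_sq_expectation P (fun t => \det (M t)))%E /\
      (abs_sq_expectation P (fun t => \det (M t))
         <= (C * (n%:R `^ (1 / 2) * n`!%:R))%:E)%E]).
Proof.
split; [move=> sigma2 _|split].
- split.
  + move=> n d T P M wig on; have := wigner_expect_det wig.
    by rewrite /mean_det on.
  + move=> n d T P M wig on; have := wigner_expect_det wig.
    by rewrite /mean_det (negbTE on).
  (* The error term is chosen before the ensemble; this is possible because the closed form depends
     on [n] alone. *)
  + have [eps [eps0 epsE]] := mean_det_asymptotics R.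
    exists eps; split=> // n d T P M wig n0 on.
    by rewrite -epsE// -rmorph_mean_det; exact: wigner_expect_det wig.
- exists 3^-1, 4; split=> [||n d T P M n0 goe]; rewrite ?invr_gt0//.
  rewrite (GOE_expect_det_sqr goe) !lee_fin.
  by have /andP[] := sqr_det2_bounds R n0.
- exists 2^-1, 2; split=> [||n d T P M n0 gue]; rewrite ?invr_gt0//.
  rewrite (GUE_expect_det_sqr gue) !lee_fin.
  by have /andP[] := sqr_det1_bounds R n0.
Qed.
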